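(* For every fixed integer $l\ge 2$, as $k\to\infty$ the number of regular subdivisions of $\Delta^l\times\Delta^k$ grows as $2^{\Theta(k\log k)}$, while the number of non-regular subdivisions of $\Delta^l\times\Delta^k$ grows as $2^{\Omega(k^2)}$.
   Context: $\Delta^m$ is the $m$-dimensional simplex. A cell of a polytope $P\subset\mathbb{R}^d$ is a sub-polytope of the same dimension as $P$ whose vertices are a subset of the vertices of $P$. A (polyhedral) subdivision of $P$ is a family of cells that covers $P$ and such that any two cells intersect in a common (possibly empty) face of both. A subdivision $S$ is regular if there is a height function $h:\mathrm{vertices}(P)\to\mathbb{R}$ such that for every cell $B\in S$ the points $(v,h(v))$, $v$ a vertex of $B$, lie in a (non-vertical) hyperplane of the affine span of $P$ times $\mathbb{R}$ that passes strictly below all points $(w,h(w))$ with $w$ a vertex of $P$ not in $B$. Otherwise $S$ is non-regular. Subdivisions are counted as labeled objects (not up to symmetry). *)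

(* Defs.v *)
From mathcomp Require Import all_boot all_order all_algebra.
From mathcomp Require Import all_classical all_reals all_analysis.

Set Implicit Arguments.
Unset Strict Implicit.
Unset Printing Implicit Defensive.

Import Order.TTheory GRing.Theory Num.Theory.

Local Open Scope classical_set_scope.
Local Open Scope ring_scope.

(* A polytope P in R^d is given by its vertices [p v], labeled by a finite type
   [V].  The vertices are in convex position, so a sub-polytope whose vertices
   are vertices of P is the same thing as its set of labels [B : {set V}]. *)

Definition hull (R : realType) (d : nat) (V : finType) (p : V -> 'rV[R]_d)
    (B : {set V}) : set 'rV[R]_d :=
  [set x | exists a : V -> R,
     [/\ forall v, v \in B -> 0 <= a v,
         \sum_(v in B) a v = 1 &
         x = \sum_(v in B) a v *: p v] ].

(* One plus the dimension of [hull p B]: the dimension of the linear span of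
   the points (1, p v), v in B.  It is 0 when [B] is empty. *)
Definition affrank (R : realType) (d : nat) (V : finType) (p : V -> 'rV[R]_d)
    (B : {set V}) : nat :=
  \rank (\sum_(v in B) <<row_mx (1 : 'rV[R]_1) (p v)>>)%MS.

Definition cell (R : realType) (d : nat) (V : finType) (p : V -> 'rV[R]_d)
    (B : {set V}) : Prop :=
  affrank p B = affrank p [set: V]%SET.

(* The empty face is obtained with [c = 0], [b = 1], and [Q] itself with
   [c = 0], [b = 0]. *)
Definition face (R : realType) (d : nat) (F Q : set 'rV[R]_d) : Prop :=
  exists (c : {scalar 'rV[R]_d}) (b : R),
    (forall x, Q x -> c x <= b) /\ F = Q `&` [set x | c x = b].

Definition subdivision (R : realType) (d : nat) (V : finType)
    (p : V -> 'rV[R]_d) (S : {set {set V}}) : Prop :=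
  [/\ forall B, B \in S -> cell p B,
      hull p [set: V]%SET `<=` \bigcup_(B in [set` S]) hull p B &
      forall B C, B \in S -> C \in S ->
        face (hull p B `&` hull p C) (hull p B) /\
        face (hull p B `&` hull p C) (hull p C)].

(* A non-vertical hyperplane of aff(P) x R is the graph over aff(P) of an
   affine function x |-> c x + b. *)
Definition is_regular (R : realType) (d : nat) (V : finType) (p : V -> 'rV[R]_d)
    (S : {set {set V}}) : Prop :=
  exists h : V -> R, forall B, B \in S ->
    exists (c : {scalar 'rV[R]_d}) (b : R),
      (forall v, v \in B -> h v = c (p v) + b) /\
      (forall w, w \notin B -> c (p w) + b < h w).

Definition regular_subdivisions (R : realType) (d : nat) (V : finType)
    (p : V -> 'rV[R]_d) : {set {set {set V}}} :=
  [set S | `[< subdivision p S /\ is_regular p S >]]%SET.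

Definition nonregular_subdivisions (R : realType) (d : nat) (V : finType)
    (p : V -> 'rV[R]_d) : {set {set {set V}}} :=
  [set S | `[< subdivision p S /\ ~ is_regular p S >]]%SET.

Definition simplex_vertex (R : realType) (m : nat) (i : 'I_m.+1) :
    'rV[R]_m.+1 := delta_mx 0 i.

Definition prod_vertex (R : realType) (d e : nat) (V W : finType)
    (p : V -> 'rV[R]_d) (q : W -> 'rV[R]_e) (u : V * W) : 'rV[R]_(d + e) :=
  row_mx (p u.1) (q u.2).

Definition prod_simplices_vertex (R : realType) (l k : nat) :
    'I_l.+1 * 'I_k.+1 -> 'rV[R]_(l.+1 + k.+1) :=
  prod_vertex (@simplex_vertex R l) (@simplex_vertex R k).

(* The hull of the product vertices is the product of the hulls, and the
   product vertices are in convex position, as [cell] requires. *)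
Lemma hull_prod (R : realType) (d e : nat) (V W : finType)
    (p : V -> 'rV[R]_d) (q : W -> 'rV[R]_e) (x : 'rV[R]_(d + e)) :
  hull (prod_vertex p q) [set: V * W]%SET x <->
  hull p [set: V]%SET (lsubmx x) /\ hull q [set: W]%SET (rsubmx x).
Proof.
have bT (T : finType) (U : nmodType) (F : T -> U) :
    \sum_(t in [set: T]%SET) F t = \sum_t F t.
  by apply: eq_bigl => t; rewrite inE.
split=> [[a [a0 a1 ->]]|[[a [a0 a1 xa]] [b [b0 b1 xb]]]].
- rewrite !bT in a1 *; split.
  + exists (fun v => \sum_w a (v, w)); split=> [v _||].
    * by apply: sumr_ge0 => w _; apply: a0; rewrite inE.
    * by rewrite bT pair_bigA -a1; apply: eq_bigr => -[].
    * rewrite bT linear_sum (eq_bigr (fun v => \sum_w a (v, w) *: p v)).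
        rewrite pair_bigA; apply: eq_bigr => -[v w] _.
        by rewrite linearZ /= /prod_vertex row_mxKl.
      by move=> v _; rewrite scaler_suml.
  + exists (fun w => \sum_v a (v, w)); split=> [w _||].
    * by apply: sumr_ge0 => v _; apply: a0; rewrite inE.
    * by rewrite bT exchange_big pair_bigA -a1; apply: eq_bigr => -[].
    * rewrite bT linear_sum (eq_bigr (fun w => \sum_v a (v, w) *: q w)).
        rewrite exchange_big pair_bigA; apply: eq_bigr => -[v w] _.
        by rewrite linearZ /= /prod_vertex row_mxKr.
      by move=> w _; rewrite scaler_suml.
- rewrite !bT in a1 b1 xa xb.
  exists (fun u => a u.1 * b u.2); split=> [u _||].
  + by rewrite mulr_ge0 ?a0 ?b0 ?inE.
  + rewrite bT -(pair_bigA _ (fun v w => a v * b w)) /= -[RHS]a1.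
    by apply: eq_bigr => v _; rewrite -mulr_sumr b1 mulr1.
  + rewrite bT -[LHS]hsubmxK xa xb.
    apply/rowP => j; rewrite summxE.
    rewrite -(pair_bigA _ (fun v w =>
      ((a v * b w) *: prod_vertex p q (v, w)) 0 j)) /=.
    rewrite -(splitK j); case: (fintype.split j) => i /=.
    * rewrite row_mxEl summxE; apply: eq_bigr => v _.
      under eq_bigr => w _ do rewrite mxE row_mxEl /= mulrAC.
      by rewrite -mulr_sumr b1 mulr1 mxE.
    * rewrite row_mxEr summxE exchange_big; apply: eq_bigr => w _.
      under eq_bigr => v _ do rewrite mxE row_mxEr /= -mulrA.
      by rewrite -mulr_suml a1 mul1r mxE.
Qed.

Lemma prod_simplices_convex_position (R : realType) (l k : nat)
    (u : 'I_l.+1 * 'I_k.+1) (B : {set 'I_l.+1 * 'I_k.+1}) :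
  hull (@prod_simplices_vertex R l k) B (prod_simplices_vertex R u) ->
  u \in B.
Proof.
case: u => i j [a [a0 a1 E]]; apply/negPn/negP => uB.
have El : \sum_(v in B) a v * (v.1 == i)%:R = 1.
  have := congr1 (fun y : 'rV[R]_(l.+1 + k.+1) => y 0 (lshift k.+1 i)) E.
  rewrite summxE row_mxEl mxE !eqxx /= => E1; apply: etrans (esym E1); apply: eq_bigr => -[v w] _ /=.
  by rewrite mxE row_mxEl mxE eqxx eq_sym.
have Er : \sum_(v in B) a v * (v.2 == j)%:R = 1.
  have := congr1 (fun y : 'rV[R]_(l.+1 + k.+1) => y 0 (rshift l.+1 j)) E.
  rewrite summxE row_mxEr mxE !eqxx /= => E1; apply: etrans (esym E1); apply: eq_bigr => -[v w] _ /=.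
  by rewrite mxE row_mxEr mxE eqxx eq_sym.
have : \sum_(v in B) a v * (v.1 == i)%:R + \sum_(v in B) a v * (v.2 == j)%:R
    <= \sum_(v in B) a v.
  rewrite -big_split; apply: ler_sum => -[v w] vB /=.
  have := a0 _ vB; have [vi|] := eqVneq v i; have [wj|] := eqVneq w j;
    rewrite ?mulr1 ?mulr0 ?addr0 ?add0r //.
  by rewrite vi wj (negPf uB) in vB.
by rewrite El Er a1 gerDl ler10.
Qed.

(* Main.v *)
Require Import Defs.
From HB Require Import structures.
From mathcomp Require Import all_boot all_order all_algebra.
From mathcomp Require Import all_classical all_reals all_analysis.
From mathcomp Require Import perm ring lra zify.

(** The regular subdivision with heights [h] consists of the cells on which some
affine function below [h] is tight; linear programming duality (Farkas) shows
that these cells cover the polytope.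

Regular subdivisions, upper bound: a cell of [Delta^l x Delta^k] is a connected
bipartite graph, so the slopes of its supporting function are signed sums of
heights along walks with at most [l] steps.  Hence the subdivision is determined
by the signs of polynomially (in [k]) many linear forms in the
[(l + 1) (k + 1)] heights, and [m] forms in dimension [n] have at most
[(3 m + 1) ^ n] sign vectors.  Lower bound: heights [sigma j] on one row, for
permutations [sigma] of the columns, give [(k + 1)!] different subdivisions.

Non-regular subdivisions: a regular subdivision is built whose cells contain
[n ^ 2] hexagons (6-cycles on the rows 0, 1, 2), where [n = (k + 1) / 4], and
which is otherwise generic.  For every set of hexagons, the cells around them can
be refined independently by flipping these hexagons.  This gives [2 ^ (n ^ 2)]
subdivisions, of which only [2 ^ O(k log k)] are regular. *)

Set Implicit Arguments.
Unset Strict Implicit.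
Unset Printing Implicit Defensive.

Import Order.TTheory GRing.Theory Num.Theory.

Local Open Scope classical_set_scope.
Local Open Scope ring_scope.

(** * Linear functionals and Farkas' lemma *)

Definition pair_col (R : realFieldType) (d : nat) (D : 'cV[R]_d) (x : 'rV[R]_d) : R^o :=
  (x *m D) 0 0.

Section PairCol.
Variables (R : realFieldType) (d : nat).
Implicit Types (D E : 'cV[R]_d) (x y : 'rV[R]_d) (a : R).

Fact pair_col_is_linear D : linear (pair_col D).
Proof. by move=> a x y; rewrite /pair_col mulmxDl -scalemxAl !mxE. Qed.

HB.instance Definition _ D :=
  GRing.isLinear.Build R 'rV[R]_d R^o *:%R (pair_col D) (pair_col_is_linear D).

Lemma pair_colZ a D x : pair_col D (a *: x) = a * pair_col D x.
Proof. by rewrite linearZ. Qed.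

Lemma pair_colDl D E x : pair_col (D + E) x = pair_col D x + pair_col E x.
Proof. by rewrite /pair_col mulmxDr mxE. Qed.

Lemma pair_colZl a D x : pair_col (a *: D) x = a * pair_col D x.
Proof. by rewrite /pair_col -scalemxAr mxE. Qed.

Lemma pair_colNl D x : pair_col (- D) x = - pair_col D x.
Proof. by rewrite /pair_col mulmxN mxE. Qed.

Lemma scalar_pair_col (c : {scalar 'rV[R]_d}) : exists D, c =1 pair_col D.
Proof.
exists (\col_i c (delta_mx 0 i)) => x.
rewrite [in LHS](row_sum_delta x) linear_sum /pair_col mxE.
by apply: eq_bigr => i _; rewrite linearZ mxE.
Qed.

End PairCol.

Section Farkas.
Variables (R : realFieldType) (n : nat) (V : eqType).

(** Induction on the generators: a functional [D] separating [X] from the cone of the tail fails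
    only if it is positive on the new generator [q], and then all points are projected along
    [P q]. *)
Lemma farkas (s : seq V) (P : V -> 'rV[R]_n) (X : 'rV[R]_n) : uniq s ->
  (exists2 a : V -> R, forall v, 0 <= a v & X = \sum_(v <- s) a v *: P v) \/
  (exists2 D : 'cV[R]_n, forall v, v \in s -> pair_col D (P v) <= 0
                       & 0 < pair_col D X).
Proof.
elim: s P X => [|q s IH] P X /= => [_|/andP[qs us]].
  have [->|X0] := eqVneq X 0; first by left; exists (fun=> 0); rewrite ?big_nil.
  right; exists X^T => //.
  have /rV0Pn[i Xi0] := X0.
  rewrite /pair_col mxE (bigD1 i) //= mxE ltr_pwDl ?sumr_ge0 // => [|j _].
    by rewrite lt_def mulf_neq0 //= -expr2 sqr_ge0.
  by rewrite mxE -expr2 sqr_ge0.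
have [[a a0 ->]|[D sD XD]] := IH P X us.
  left; exists (fun v => if v == q then 0 else a v) => [v|]; first by case: eqP.
  rewrite big_cons eqxx scale0r add0r; apply: eq_big_seq => v vs.
  by case: eqP => // vq; rewrite -vq vs in qs.
have [qD|qD] := leP (pair_col D (P q)) 0.
  by right; exists D => // v; rewrite inE => /predU1P[->//|/sD].
set e := pair_col D (P q) in qD.
pose r (Y : 'rV[R]_n) := pair_col D Y / e.
(* Project along [P q] onto the hyperplane where [D] vanishes. *)
have [[a a0 Xa]|[D' sD' XD']] :=
    IH (fun v => P v - r (P v) *: P q) (X - r X *: P q) us.
  left; exists (fun v => if v == q then r X - \sum_(w <- s) a w * r (P w) else a v).
    move=> v; case: eqP => // _; rewrite subr_ge0.
    apply: (@le_trans _ _ 0); last by rewrite divr_ge0 ?ltW.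
    rewrite big_seq_cond; apply: sumr_le0 => w /andP[ws _].
    by rewrite mulr_ge0_le0 // /r mulr_le0_ge0 ?sD // invr_ge0 ltW.
  rewrite big_cons eqxx scalerBl addrAC -addrA.
  rewrite -[LHS](subrK (r X *: P q)) Xa [RHS]addrC; congr (_ + _).
  rewrite scaler_suml -sumrB; apply: eq_big_seq => v vs.
  case: eqP => [vq|_]; first by rewrite -vq vs in qs.
  by rewrite scalerBr scalerA.
(* This is [D'] composed with the projection, so it vanishes on [P q]. *)
right; exists (D' - (pair_col D' (P q) / e) *: D) => [v|].
  rewrite pair_colDl pair_colNl pair_colZl inE => /predU1P[->|vs].
    by rewrite -/e divfK ?gt_eqF// subrr.
  have := sD' v vs; rewrite linearB /= pair_colZ.
  by rewrite /r mulrAC [pair_col D' _ / e * _]mulrAC (mulrC (pair_col D _)).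
move: XD'; rewrite linearB /= pair_colZ pair_colDl pair_colNl pair_colZl.
by rewrite /r mulrAC [pair_col D' _ / e * _]mulrAC (mulrC (pair_col D X)).
Qed.

End Farkas.

(** * Affine functions, cells and faces *)

Lemma mulmx_col (S : pzRingType) m n q (A : 'M[S]_(m, n)) (B : 'M[S]_(n, q)) i j :
  (A *m col j B) i 0 = (A *m B) i j.
Proof. by rewrite !mxE; apply: eq_bigr => k _; rewrite mxE. Qed.

Section Configuration.
Variables (R : realType) (d : nat) (V : finType) (p : V -> 'rV[R]_d).
Implicit Types (B C : {set V}) (psi : 'cV[R]_(1 + d)) (a b : V -> R).

(** Homogenization: affine functions become columns [psi], and affine dependencies become linear
    dependencies of the [hpt v]. *)
Definition hpt v : 'rV[R]_(1 + d) := row_mx 1 (p v).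

Definition aff psi v : R := pair_col psi (hpt v).

Lemma affD psi chi v : aff (psi + chi) v = aff psi v + aff chi v.
Proof. exact: pair_colDl. Qed.

Lemma affN psi v : aff (- psi) v = - aff psi v.
Proof. exact: pair_colNl. Qed.

Lemma affZ (t : R) psi v : aff (t *: psi) v = t * aff psi v.
Proof. exact: pair_colZl. Qed.

Lemma pair_col_row1 psi (x : 'rV[R]_d) :
  pair_col psi (row_mx 1 x) = pair_col (dsubmx psi) x + pair_col (usubmx psi) 1.
Proof. by rewrite /pair_col -{1}(vsubmxK psi) mul_row_col mxE addrC. Qed.

Lemma aff_scalar psi : exists (c : {scalar 'rV[R]_d}) (t : R),
  forall v, aff psi v = c (p v) + t.
Proof.
exists (pair_col (dsubmx psi) : {scalar _}), (pair_col (usubmx psi) 1); move=> v.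
exact: pair_col_row1.
Qed.

Lemma scalar_aff (c : {scalar 'rV[R]_d}) (t : R) :
  exists psi, forall v, aff psi v = c (p v) + t.
Proof.
have [D cD] := scalar_pair_col c; exists (col_mx (t%:M : 'M[R]_1) D); move=> v.
rewrite /aff pair_col_row1 col_mxKd col_mxKu cD; congr (_ + _).
by rewrite /pair_col mul1mx mxE eqxx.
Qed.

Lemma pair_col_comb psi a :
  pair_col psi (\sum_v a v *: hpt v) = \sum_v a v * aff psi v.
Proof. rewrite linear_sum; by apply: eq_bigr => v _ /=; rewrite pair_colZ. Qed.

Lemma aff_comb psi a b : \sum_v a v *: hpt v = \sum_v b v *: hpt v ->
  \sum_v a v * aff psi v = \sum_v b v * aff psi v.
Proof. by rewrite -!pair_col_comb => ->. Qed.

Lemma sum_supp (U : nmodType) B (F : V -> U) : (forall v, v \notin B -> F v = 0) ->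
  \sum_v F v = \sum_(v in B) F v.
Proof.
by move=> F0; rewrite [RHS]big_mkcond; apply: eq_bigr => v _; case: ifPn => // /F0.
Qed.

(** The first coordinate of [hpt] encodes that the weights sum to 1. Extending weights by zero lets
    combinations over different cells be compared. *)
Lemma hullP B (x : 'rV[R]_d) : hull p B x <->
  exists a, [/\ forall v, 0 <= a v, forall v, v \notin B -> a v = 0 &
                \sum_v a v *: hpt v = row_mx 1 x].
Proof.
have E a : \sum_(v in B) a v *: hpt v =
    row_mx (\sum_(v in B) a v)%:M (\sum_(v in B) a v *: p v).
  rewrite -[LHS]hsubmxK !linear_sum; congr row_mx.
    apply/matrixP => i j; rewrite !ord1 mxE eqxx summxE.
    by apply: eq_bigr => v _; rewrite linearZ /= row_mxKl !mxE mulr1.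
  by apply: eq_bigr => v _; rewrite linearZ /= row_mxKr.
split=> [[a [a0 a1 ->]]|[a [a0 aB ax]]].
  exists (fun v => if v \in B then a v else 0); split=> [v|v /negPf->//|].
    by case: ifP => // /a0.
  rewrite (@sum_supp _ B) => [|v /negPf->]; last by rewrite scale0r.
  by rewrite (eq_bigr (fun v => a v *: hpt v)) => [|v ->//]; rewrite E a1.
rewrite (@sum_supp _ B) in ax => [|v /aB->]; last by rewrite scale0r.
rewrite E in ax; have [/matrixP/(_ 0 0) + x1] := eq_row_mx ax.
by rewrite !mxE !eqxx => a1; exists a; split.
Qed.

Lemma affrank_mx B : affrank p B = \rank (\matrix_(i < #|V|)
  (if enum_val i \in B then hpt (enum_val i) else 0))%R.
Proof.
rewrite /affrank.
have -> : (\sum_(v in B) <<row_mx (1 : 'rV[R]_1) (p v)>> :=: \matrix_(i < #|V|)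
  (if enum_val i \in B then hpt (enum_val i) else 0))%MS; last by [].
apply/eqmxP/andP; split.
  apply/sumsmx_subP => v vB; rewrite genmxE.
  rewrite (_ : row_mx _ _ = row (enum_rank v) (\matrix_(i < #|V|)
      (if enum_val i \in B then hpt (enum_val i) else 0))) ?row_sub//.
  by rewrite rowK enum_rankK vB.
apply/row_subP => i; rewrite rowK; case: ifP => [iB|_]; last exact: sub0mx.
by apply: (sumsmx_sup (enum_val i)) => //; rewrite genmxE.
Qed.

(** Nested row spaces have equal rank iff they are equal, that is, iff they have the same
    annihilator. *)
Lemma cellP B :
  cell p B <-> forall psi, (forall v, v \in B -> aff psi v = 0) ->
               forall v, aff psi v = 0.
Proof.
rewrite /cell !affrank_mx.
set M := (\matrix_(i < _) _); set N := (\matrix_(i < _) _).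
have rN v : row (enum_rank v) N = hpt v by rewrite rowK enum_rankK inE.
have rM v : v \in B -> row (enum_rank v) M = hpt v.
  by rewrite rowK enum_rankK => ->.
have MN : (M <= N)%MS.
  apply/row_subP => i; rewrite rowK; case: ifP => _; last exact: sub0mx.
  by rewrite -(enum_valK i) enum_rankK -rN row_sub.
split=> [rk psi psiB v|H].
  have NM : (N <= M)%MS by rewrite -(geq_leqif (mxrank_leqif_sup MN)) rk.
  have : (hpt v <= M)%MS by rewrite -rN (submx_trans (row_sub _ _)).
  case/submxP => D; rewrite /aff /pair_col => ->; rewrite -mulmxA.
  rewrite (_ : M *m psi = 0) ?mulmx0 ?mxE//; apply/row_matrixP => i.
  rewrite row_mul row0 rowK; case: ifP => iB; last by rewrite mul0mx.
  by apply/matrixP => j k; rewrite !ord1 [RHS]mxE; exact: psiB.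
apply/eqP; rewrite (mxrank_leqif_sup MN).2; apply/row_subP => i.
rewrite rowK inE submxE; apply/eqP/rowP => j; rewrite [RHS]mxE.
have E : aff (col j (cokermx M)) (enum_val i) = 0.
  apply: H => v vB; rewrite /aff /pair_col -(rM v vB) mulmx_col -row_mul.
  by rewrite mulmx_coker row0 mxE.
by move: E; rewrite /aff /pair_col mulmx_col => ->.
Qed.

(** Linear duality: [G] lies in the row space of [M^T] iff the cokernel kills it, and the columns of
    this cokernel, cut down to [B], are affine dependencies supported in [B]. *)
Lemma affine_extension B (g : V -> R) :
  (forall a, (forall v, v \notin B -> a v = 0) -> \sum_v a v *: hpt v = 0 ->
     \sum_v a v * g v = 0) ->
  exists psi, forall v, v \in B -> aff psi v = g v.
Proof.
move=> H; pose M := \matrix_(i < #|V|) (if enum_val i \in B then hpt (enum_val i) else 0).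
pose G := \row_(i < #|V|) (if enum_val i \in B then g (enum_val i) else 0).
have /submxP[D GD] : (G <= M^T)%MS.
  rewrite submxE; apply/eqP/rowP => j; rewrite [RHS]mxE.
  pose a v := if v \in B then cokermx M^T (enum_rank v) j else 0.
  have := H a; rewrite /a => /(_ _)/wrap[v /negPf->//|H1].
  rewrite mxE -[RHS]H1.
    rewrite (reindex_onto enum_rank enum_val) => [|i _]; last by rewrite enum_valK.
    rewrite (eq_bigl xpredT) => [|v]; last by rewrite enum_rankK eqxx.
    apply: eq_bigr => v _; rewrite mxE enum_rankK mulrC.
    by case: ifP => _; rewrite ?mulr0 ?mul0r.
  apply/rowP => q; rewrite summxE [RHS]mxE.
  have /matrixP/(_ q j) E := mulmx_coker M^T; rewrite [RHS]mxE in E.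
  apply: etrans E; rewrite [RHS]mxE.
  rewrite [RHS](reindex_onto enum_rank enum_val) => [|i _]; last by rewrite enum_valK.
  rewrite [RHS](eq_bigl xpredT) => [|v]; last by rewrite enum_rankK eqxx.
  apply: eq_bigr => v _; rewrite !mxE enum_rankK mulrC.
  by case: ifP => _; rewrite ?mulr0 ?mul0r ?mxE ?mulr0 ?mul0r.
exists D^T => v vB; rewrite /aff /pair_col.
have -> : hpt v = row (enum_rank v) M by rewrite rowK enum_rankK vB.
rewrite -row_mul -[M]trmxK -trmx_mul -GD !mxE enum_rankK vB //.
Qed.

(** On a common point of both hulls [psi] is at once nonpositive and nonnegative. Conversely, a
    point of the hull of [B] where [psi] vanishes only uses vertices where [psi] vanishes, and these
    lie in [C]. *)
Lemma face_of_sep B C psi :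
  (forall v, v \in B -> aff psi v <= 0) -> (forall v, v \in C -> 0 <= aff psi v) ->
  (forall v, v \in B -> aff psi v = 0 -> v \in C) ->
  face (hull p B `&` hull p C) (hull p B).
Proof.
move=> psiB psiC BC.
have val a B' x : (forall v, v \notin B' -> a v = 0) ->
    \sum_v a v *: hpt v = row_mx 1 x ->
    pair_col (dsubmx psi) x + pair_col (usubmx psi) 1 = \sum_(v in B') a v * aff psi v.
  move=> a0 ax; rewrite -pair_col_row1 -ax pair_col_comb (@sum_supp _ B') //.
  by move=> v /a0->; rewrite mul0r.
exists (pair_col (dsubmx psi) : {scalar _}), (- pair_col (usubmx psi) 1).
split=> [x|].
  move=> /hullP[a [a0 aB ax]]; rewrite -subr_le0 opprK (val a B) //.
  by apply: sumr_le0 => v vB; rewrite mulr_ge0_le0 ?psiB.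
apply/seteqP; split=> x /= [].
  move=> xB /hullP[b [b0 bC bx]]; split=> //; case/hullP: (xB) => a [a0 aB ax].
  apply/eqP; rewrite -addr_eq0 eq_le; apply/andP; split.
    by rewrite (val a B) //; apply: sumr_le0 => v vB; rewrite mulr_ge0_le0 ?psiB.
  by rewrite (val b C) //; apply: sumr_ge0 => v vC; rewrite mulr_ge0 ?psiC.
move=> xB /eqP; rewrite -addr_eq0 => /eqP xE; split=> //.
case/hullP: (xB) => a [a0 aB ax]; apply/hullP; exists a; split=> // v vC.
have [vB|/aB//] := boolP (v \in B).
apply/eqP; apply: contraNT vC => av; apply: BC => //.
move: xE; rewrite (val a B) // => /eqP; rewrite -oppr_eq0 -sumrN.
rewrite psumr_eq0 => [/allP/(_ v (mem_index_enum _))|w wB]; last first.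
  by rewrite oppr_ge0 mulr_ge0_le0 ?psiB.
by rewrite vB oppr_eq0 mulf_eq0 (negPf av) => /eqP.
Qed.

End Configuration.

(** * Lower cells of a height function *)

Section LowerCells.
Variables (R : realType) (d : nat) (V : finType) (p : V -> 'rV[R]_d).
Implicit Types (B C : {set V}) (psi chi : 'cV[R]_(1 + d)) (a b h : V -> R).

Notation hpt := (hpt p).
Notation aff := (aff p).

Definition tight h psi : {set V} := [set v | aff psi v == h v].

(** These are the projections of the lower facets of the lifted points [(p v, h v)]. *)
Definition lower_cells h : {set {set V}} :=
  [set B | `[< cell p B /\ exists2 psi, forall v, aff psi v <= h v &
                                        B = tight h psi >]].

Lemma lower_cellsP h B : reflect
  (cell p B /\ exists2 psi, forall v, aff psi v <= h v & B = tight h psi)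
  (B \in lower_cells h).
Proof. by rewrite inE; apply: asboolP. Qed.

Lemma cell_aff_eq B psi chi : cell p B ->
  (forall v, v \in B -> aff psi v = aff chi v) -> aff psi =1 aff chi.
Proof.
move=> /cellP cB E v; apply/eqP; rewrite -subr_eq0 -affN -affD; apply/eqP/cB => w wB.
by rewrite affD affN E // subrr.
Qed.

(** The two supporting functions agree on the cell [B], hence everywhere. *)
Lemma lower_cells_antichain h B C : B \in lower_cells h -> C \in lower_cells h ->
  B \subset C -> B = C.
Proof.
move=> /lower_cellsP[cB [psi _ Bt]] /lower_cellsP[_ [chi _ Ct]] /fintype.subsetP BC.
suff E : aff psi =1 aff chi by rewrite Bt Ct; apply/setP => v; rewrite !inE E.
apply: (cell_aff_eq cB) => v vB; have := BC _ vB.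
by move: vB; rewrite Bt Ct !inE => /eqP-> /eqP->.
Qed.

(** Ratio test of the simplex method: [t] is the least quotient of slack by [chi] over the vertices
    where [chi] is positive, and a minimizing vertex becomes tight. *)
Lemma raise_psi h psi chi :
  (forall v, aff psi v <= h v) -> (exists v, 0 < aff chi v) ->
  (forall v, v \in tight h psi -> aff chi v <= 0) ->
  exists2 t : R, 0 < t & (forall v, aff (psi + t *: chi) v <= h v) /\
    exists2 v, 0 < aff chi v & v \in tight h (psi + t *: chi).
Proof.
move=> psih [v0 v0P] chiB.
pose F v := (h v - aff psi v) / aff chi v.
case: (@arg_minP _ _ _ v0 (fun v => 0 < aff chi v) F v0P) => v vP vmin.
have v_slack : 0 < h v - aff psi v.
  rewrite subr_gt0 lt_neqAle psih andbT; apply/negP => vt.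
  by have := chiB v; rewrite inE => /(_ vt); rewrite leNgt vP.
exists (F v); first by rewrite divr_gt0.
split=> [w|]; last first.
  by exists v; rewrite // inE affD affZ /F divfK ?lt0r_neq0 // addrC subrK.
rewrite affD affZ -lerBrDl; have [wP|wN] := ltP 0 (aff chi w).
  by rewrite -ler_pdivlMr //; apply: vmin.
apply: (@le_trans _ _ 0); last by rewrite subr_ge0.
by rewrite mulr_ge0_le0 // divr_ge0 ?ltW.
Qed.

Lemma exists_aff_gt0 chi a : (forall v, 0 <= a v) ->
  0 < pair_col chi (\sum_v a v *: hpt v) -> exists v, 0 < aff chi v.
Proof.
move=> a0; apply: contraPP => /forallNP chiN.
apply/negP; rewrite -leNgt pair_col_comb; apply: sumr_le0 => v _.
by rewrite mulr_ge0_le0 // leNgt; apply/negP/chiN.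
Qed.

(** While the tight set is no cell, some nonzero affine function vanishes on it, and raising [psi]
    along this function makes a further vertex tight. The induction is on the number of vertices
    that are not tight. *)
Lemma grow_to_cell h psi a :
  (forall v, 0 <= a v) -> (forall v, aff psi v <= h v) ->
  exists chi, [/\ forall v, aff chi v <= h v, cell p (tight h chi),
    pair_col psi (\sum_v a v *: hpt v) <= pair_col chi (\sum_v a v *: hpt v) &
    tight h psi \subset tight h chi].
Proof.
move=> a0; have [n] := ubnP (#|V| - #|tight h psi|).
elim: n psi => // n IH psi; rewrite ltnS => le_n psih.
have [cl|ncell] := pselect (cell p (tight h psi)); first by exists psi; split.
have [chi chi0 [chiX chiw]] : exists2 chi, forall v, v \in tight h psi -> aff chi v = 0 &
    0 <= pair_col chi (\sum_v a v *: hpt v) /\ exists v, 0 < aff chi v.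
  have [chi [chi0 [w chiw]]] : exists chi,
      (forall v, v \in tight h psi -> aff chi v = 0) /\ exists w, aff chi w != 0.
    apply: contrapT => H; apply: ncell; apply/cellP => chi chi0 v.
    apply: contrapT => /eqP chiv; apply: H; exists chi; split=> //.
    by exists v.
  have N0 v : v \in tight h psi -> aff (- chi) v = 0.
    by move=> /chi0; rewrite affN => ->; rewrite oppr0.
  (* The sign of [chi] is chosen so that the value at the given point does not decrease. If that
     value is 0, the sign is chosen to make [chi] positive at [w]. *)
  case: (ltgtP (pair_col chi (\sum_v a v *: hpt v)) 0) => [chiX|chiX|chiX].
  - have chiX' : 0 < pair_col (- chi) (\sum_v a v *: hpt v).
      by rewrite pair_colNl oppr_gt0.
    by exists (- chi) => //; split; [exact: ltW|exact: exists_aff_gt0 chiX'].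
  - by exists chi => //; split; [exact: ltW|exact: exists_aff_gt0 chiX].
  have [wP|wN|/eqP] := ltgtP (aff chi w) 0; last by rewrite (negPf chiw).
    exists (- chi) => //; rewrite pair_colNl chiX oppr0; split=> //.
    by exists w; rewrite affN oppr_gt0.
  by exists chi => //; rewrite chiX; split=> //; exists w.
have [|t t0 [th [v vP vt]]] := raise_psi psih chiw; first by move=> v /chi0->.
have sub : tight h psi \subset tight h (psi + t *: chi).
  apply/fintype.subsetP => u ut; have := ut; rewrite !inE affD affZ chi0 // => /eqP->.
  by rewrite mulr0 addr0.
have [|psi' [psi'h psi'c psi'X psi't]] := IH (psi + t *: chi) _ th.
  have lt : (#|tight h psi| < #|tight h (psi + t *: chi)|)%N.
    apply: proper_card; apply/properP; split=> //; exists v => //.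
    by apply/negP => /chi0 v0; rewrite v0 ltxx in vP.
  apply: leq_trans le_n; apply: ltn_sub2l => //.
  exact: leq_trans lt (max_card _).
exists psi'; split=> //; last exact: fintype.subset_trans sub psi't.
by apply: le_trans psi'X; rewrite pair_colDl pair_colZl lerDl mulr_ge0 ?(ltW t0).
Qed.

Lemma exists_aff_below h : exists psi, forall v, aff psi v <= h v.
Proof.
have [psi psiE] := scalar_aff p (pair_col 0 : {scalar _}) (- \sum_v `|h v|).
exists psi => v; rewrite psiE /= /pair_col mulmx0 mxE add0r lerNl.
apply: (@le_trans _ _ `|h v|); first by rewrite -normrN ler_norm.
by rewrite (bigD1 v) //= lerDl sumr_ge0.
Qed.

(** Take the lower cell whose supporting function is largest at [X]. If [X] were outside its cone,
    Farkas would give a direction in which to raise this function, and growing the result to a cell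
    would give a larger value at [X]. *)
Lemma lower_cells_cover h a : (forall v, 0 <= a v) ->
  exists2 B, B \in lower_cells h &
  exists b, [/\ forall v, 0 <= b v, forall v, v \notin B -> b v = 0 &
                \sum_v b v *: hpt v = \sum_v a v *: hpt v].
Proof.
move=> a0; set X := \sum_v a v *: hpt v.
have grown psi : (forall v, aff psi v <= h v) -> exists chi,
    [/\ tight h chi \in lower_cells h, forall v, aff chi v <= h v &
     pair_col psi X <= pair_col chi X].
  move=> /(grow_to_cell a0)[chi [chih chic chiX _]].
  by exists chi; split=> //; apply/lower_cellsP; split=> //; exists chi.
have /choice[f fP] B : exists psi, B \in lower_cells h ->
    (forall v, aff psi v <= h v) /\ B = tight h psi.
  have [/lower_cellsP[_ [psi]]|] := boolP (B \in lower_cells h); last by exists 0.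
  by exists psi.
have [psi0 /grown[chi0 [chi0L _ _]]] := exists_aff_below h.
pose F B := pair_col (f B) X.
case: (@arg_maxP _ _ _ _ (mem (lower_cells h)) F chi0L) => B BL Bmax.
have [fh fB] := fP B BL.
exists B => //.
have [[b b0 Xb]|[chi chiB chiX]] := farkas hpt X (enum_uniq B).
  exists (fun v => if v \in B then b v else 0); split=> [v|v /negPf->//|].
    by case: ifP.
  rewrite Xb big_enum (@sum_supp _ _ B) => [|v /negPf->]; last by rewrite scale0r.
  by apply: eq_bigr => v ->.
have [v|t t0 [th _]] := raise_psi fh (exists_aff_gt0 a0 chiX).
  by rewrite -fB => vB; apply: chiB; rewrite mem_enum.
have [psi [psiL psih psiX]] := grown _ th.
have := Bmax _ psiL; rewrite /= leNgt => /negP[].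
have [gh gt] := fP _ psiL.
(* The chosen [f] may return another column than [psi], but both induce the same function since they
   agree on a cell. *)
have E : aff (f (tight h psi)) =1 aff psi.
  apply: (cell_aff_eq (proj1 (lower_cellsP _ _ psiL))) => v vt; have := vt.
  by rewrite {1}gt inE => /eqP->; move: vt; rewrite inE => /eqP.
rewrite /F; apply: (@lt_le_trans _ _ (pair_col psi X)).
  by apply: lt_le_trans psiX; rewrite pair_colDl pair_colZl ltrDl mulr_gt0.
rewrite !pair_col_comb le_eqVlt; apply/orP; left; apply/eqP.
by apply: eq_bigr => v _; rewrite E.
Qed.

(** The heights determine the subdivision: its cells are lower cells, and since they cover the
    polytope no lower cell can be missing. *)
Lemma subdivision_lower_cells S h : V -> subdivision p S ->
  (forall B, B \in S -> exists (c : {scalar 'rV[R]_d}) (t : R),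
     (forall v, v \in B -> h v = c (p v) + t) /\
     (forall w, w \notin B -> c (p w) + t < h w)) ->
  S = lower_cells h.
Proof.
move=> v0 [Scell Scov _] Sh.
have SL B : B \in S -> B \in lower_cells h.
  move=> BS; have [c [t [hB hnB]]] := Sh B BS; apply/lower_cellsP; split.
    exact: Scell.
  have [psi psiE] := scalar_aff p c t; exists psi => [v|].
    by rewrite psiE; have [/hB->//|/hnB/ltW] := boolP (v \in B).
  apply/setP => v; rewrite inE psiE; have [/hB->|/hnB/lt_eqF->//] := boolP (v \in B).
  by rewrite eqxx.
apply/setP => B; apply/idP/idP => [/SL//|BL].
have [cB [psi psih Bt]] := lower_cellsP _ _ BL.
have B0 : (0 < #|B|)%N.
  rewrite lt0n cards_eq0; apply/eqP => B0.
  have [one oneE] := scalar_aff p (pair_col 0 : {scalar _}) 1.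
  have /cellP/(_ one)/(_ _ v0) := cB.
  rewrite B0 oneE /= /pair_col mulmx0 mxE add0r => /(_ _)/wrap[v|/eqP]; first by rewrite inE.
  by rewrite oner_eq0.
(* The barycenter of [B] lies in some [C] of [S]; comparing the heights of the
   two supporting hyperplanes there forces both to agree on [B]. *)
pose a v : R := if v \in B then #|B|%:R^-1 else 0.
have a0 v : 0 <= a v by rewrite /a; case: ifP.
have [x xE] : exists x, \sum_v a v *: hpt v = row_mx 1 x.
  have [one oneE] := scalar_aff p (pair_col 0 : {scalar _}) 1.
  exists (rsubmx (\sum_v a v *: hpt v)); rewrite -[LHS]hsubmxK; congr row_mx.
  rewrite linear_sum; apply/matrixP => i j; rewrite !ord1 mxE eqxx summxE.
  rewrite (@sum_supp _ _ B) => [|v /negPf vB]; last by rewrite /a vB scale0r linear0 mxE.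
  rewrite (eq_bigr (fun=> #|B|%:R^-1)) => [|v vB].
    by rewrite sumr_const -[_ *+ _]mulr_natr mulVf // pnatr_eq0 -lt0n.
  by rewrite linearZ /= row_mxKl !mxE /a vB mulr1.
have [|C CS] := Scov x.
  by apply/hullP; exists a; split=> // v; rewrite inE.
case/hullP => b [b0 bC bx].
have [_ [chi chih Ct]] := lower_cellsP _ _ (SL _ CS).
have ab := xE; rewrite -bx in ab.
rewrite (lower_cells_antichain BL (SL _ CS)) //; apply/fintype.subsetP => v vB.
have aD w : 0 <= a w * (aff psi w - aff chi w).
  rewrite /a; have [wB|] := boolP (w \in B); last by rewrite mul0r.
  rewrite mulr_ge0 ?invr_ge0 // subr_ge0; move: wB.
  by rewrite {1}Bt inE => /eqP->.
have S0 : \sum_w a w * (aff psi w - aff chi w) = 0.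
  apply/eqP; rewrite eq_le sumr_ge0 ?andbT //.
  have E w : aff psi w - aff chi w = aff (psi - chi) w by rewrite affD affN.
  under eq_bigr do rewrite E.
  rewrite (aff_comb (psi - chi) ab); apply: sumr_le0 => w _; rewrite -E.
  have [|/bC->] := boolP (w \in C); last by rewrite mul0r.
  by rewrite Ct inE => /eqP->; rewrite mulr_ge0_le0 // subr_le0.
have /eqP := psumr_eq0P (fun w _ => aD w) S0 (erefl true : xpredT v).
rewrite mulf_eq0 /a vB invr_eq0 pnatr_eq0 -leqn0 leqNgt B0 subr_eq0 => /eqP E.
by rewrite Ct inE -E; move: vB; rewrite Bt inE.
Qed.

Lemma regular_lower_cells S : V -> subdivision p S -> is_regular p S ->
  exists h, S = lower_cells h.
Proof. by move=> v0 dS [h hS]; exists h; apply: subdivision_lower_cells. Qed.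

Lemma is_regular_lower_cells h : is_regular p (lower_cells h).
Proof.
exists h => B /lower_cellsP[_ [psi psih ->]]; have [c [t E]] := aff_scalar p psi.
exists c, t; split=> v; rewrite inE -E; first by move/eqP.
by rewrite lt_neqAle psih andbT.
Qed.

(** * Refining lower cells by deleting vertices *)

Section Refinement.
Variables (h : V -> R) (r : {set V} -> {set {set V}}).

(** Each member of [r B] is a set of vertices to delete from [B]; the empty set keeps [B] whole. *)
Definition refine_cells : {set {set V}} :=
  [set D | `[< exists B X, [/\ B \in lower_cells h, X \in r B & D = (B :\: X)%SET] >]].

Lemma refine_cellsP D : reflect
  (exists B X, [/\ B \in lower_cells h, X \in r B & D = (B :\: X)%SET])
  (D \in refine_cells).
Proof. by rewrite inE; apply: asboolP. Qed.

Hypothesis r_cell : forall B X, B \in lower_cells h -> X \in r B -> cell p (B :\: X)%SET.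
Hypothesis r_cover : forall B x, B \in lower_cells h -> hull p B x ->
  exists2 X, X \in r B & hull p (B :\: X)%SET x.
(** On the common vertices of [B] and [C] such a function is nonpositive off [X] and nonnegative off
    [Y], as [face_of_sep] requires of [B :\: X] and [C :\: Y]. *)
Hypothesis r_affine : forall B C X Y, B \in lower_cells h -> C \in lower_cells h ->
  X \in r B -> Y \in r C ->
  exists psi, forall v, v \in B -> v \in C -> aff psi v = (v \in X)%:R - (v \in Y)%:R.

(* A large multiple of the difference of the two supporting functions separates
   [B] from [C] strictly off their intersection; adding the function of
   [r_affine] corrects the signs there. *)
Lemma refine_cells_face D E : D \in refine_cells -> E \in refine_cells ->
  face (hull p D `&` hull p E) (hull p D).
Proof.
move=> /refine_cellsP[B [X [BL XB ->]]] /refine_cellsP[C [Y [CL YC ->]]].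
have [_ [psi psih Bt]] := lower_cellsP _ _ BL.
have [_ [chi chih Ct]] := lower_cellsP _ _ CL.
have [f fE] := r_affine BL CL XB YC.
have [g gE] : exists g, forall v, aff g v = aff chi v - aff psi v.
  by exists (chi - psi) => v; rewrite affD affN.
(* [N] exceeds every quotient; terms with [aff g v = 0] count as 0, since division by 0 gives 0. *)
pose N := 1 + \sum_v `|aff f v| / `|aff g v|.
have Nlt v : aff g v != 0 -> `|aff f v| < N * `|aff g v|.
  move=> gv; rewrite -ltr_pdivrMr ?normr_gt0 // /N (bigD1 v) //=.
  by rewrite addrCA ltrDl ltr_pwDl // sumr_ge0 // => w _; rewrite divr_ge0.
have gB v : v \in B -> v \notin C -> aff (N *: g + f) v < 0.
  move=> vB vC; have g0 : aff g v < 0.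
    rewrite gE subr_lt0; move: vB vC; rewrite Bt Ct !inE => /eqP-> H.
    by rewrite lt_neqAle H chih.
  have := Nlt v (ltr0_neq0 g0); rewrite affD affZ (ltr0_norm g0) ltr_norml.
  by move=> /andP[_ +]; lra.
have gC v : v \in C -> v \notin B -> 0 < aff (N *: g + f) v.
  move=> vC vB; have g0 : 0 < aff g v.
    rewrite gE subr_gt0; move: vB vC; rewrite Bt Ct !inE => H /eqP->.
    by rewrite lt_neqAle H psih.
  have := Nlt v (lt0r_neq0 g0); rewrite affD affZ (gtr0_norm g0) ltr_norml.
  by move=> /andP[+ _]; lra.
have gBC v : v \in B -> v \in C -> aff (N *: g + f) v = (v \in X)%:R - (v \in Y)%:R.
  move=> vB vC; rewrite affD affZ fE // gE.
  move: vB vC; rewrite Bt Ct !inE => /eqP-> /eqP->.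
  by rewrite subrr mulr0 add0r.
apply: (@face_of_sep _ _ _ _ _ _ (N *: g + f)) => v; rewrite !inE.
- move=> /andP[/negPf vX vB]; have [vC|/(gB _ vB)/ltW//] := boolP (v \in C).
  by rewrite gBC // vX sub0r oppr_le0.
- move=> /andP[/negPf vY vC]; have [vB|/(gC _ vC)/ltW//] := boolP (v \in B).
  by rewrite gBC // vY subr0.
- move=> /andP[/negPf vX vB]; have [vC|/(gB _ vB)/lt_eqF/eqP//] := boolP (v \in C).
  rewrite gBC // vX sub0r => /eqP; rewrite oppr_eq0 pnatr_eq0.
  by case: (v \in Y).
Qed.

Lemma refine_cells_subdivision : subdivision p refine_cells.
Proof.
split=> [D /refine_cellsP[B [X [BL XB ->]]]|x|D E DS ES].
- exact: r_cell.
- move=> /hullP[a [a0 _ ax]]; have [B BL [b [b0 bB bx]]] := lower_cells_cover h a0.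
  have [|X XB xX] := @r_cover B x BL; first by apply/hullP; exists b; rewrite bx ax.
  by exists (B :\: X)%SET => //; apply/refine_cellsP; exists B, X.
- split; first exact: refine_cells_face.
  by rewrite setIC; exact: refine_cells_face.
Qed.

End Refinement.

(** This is the refinement that deletes nothing, with 0 as correcting function. *)
Lemma lower_cells_subdivision h : subdivision p (lower_cells h).
Proof.
have E : refine_cells h (fun=> [set finset.set0]%SET) = lower_cells h.
  apply/setP => D; apply/refine_cellsP/idP => [[B [X [BL]]]|DL].
    by rewrite inE => /eqP-> ->; rewrite finset.setD0.
  by exists D, finset.set0; rewrite finset.setD0 finset.set11.
rewrite -E; apply: refine_cells_subdivision => [B X BL|B x BL xB|B C X Y _ _].
- by rewrite inE => /eqP->; rewrite finset.setD0; have [] := lower_cellsP _ _ BL.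
- by exists finset.set0; [rewrite finset.set11|rewrite finset.setD0].
- rewrite !inE => /eqP-> /eqP->; exists 0 => v _ _.
  by rewrite !inE subrr /aff /pair_col mulmx0 mxE.
Qed.

End LowerCells.

(** * Sign vectors of linear forms *)

Lemma expn_mono m n e : (m <= n)%N -> (m ^ e <= n ^ e)%N.
Proof. by case: e => // e mn; rewrite leq_exp2r. Qed.

Lemma sg_combination (R : realDomainType) (s t x y : R) : 0 < s -> 0 < t ->
  Num.sg x = Num.sg y -> Num.sg (s * x + t * y) = Num.sg x.
Proof.
move=> s0 t0; have [x0|x0|->] := ltgtP x 0.
- rewrite (ltr0_sg x0) => /esym/eqP; rewrite sgr_cp0 => y0.
  by rewrite ltr0_sg // -oppr_gt0 opprD -!mulrN addr_gt0 // mulr_gt0 ?oppr_gt0.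
- rewrite (gtr0_sg x0) => /esym/eqP; rewrite sgr_cp0 => y0.
  by rewrite gtr0_sg // addr_gt0 // mulr_gt0.
- by rewrite sgr0 => /esym/eqP; rewrite sgr_eq0 => /eqP->; rewrite !mulr0 addr0 sgr0.
Qed.

Section SignVectors.
Variables (R : realFieldType) (n : nat).
Implicit Types (W : 'M[R]_n) (fs : seq 'cV[R]_n) (u : 'rV[R]_n).

Definition sign_vector fs u : seq R := [seq Num.sg (pair_col f u) | f <- fs].

(* Passing from [fs] to [f :: fs], a sign vector splits into several ones only
   if, by convexity, it is also realized on the hyperplane [f = 0]. *)
Lemma count_sign_vectors W fs : exists2 L : seq (seq R),
  (size L <= (3 * size fs + 1) ^ \rank W)%N &
  forall u, (u <= W)%MS -> sign_vector fs u \in L.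
Proof.
elim: fs W => [|f fs IH] W; first by exists [:: [::]]; rewrite ?exp1n.
have [L1 L1s L1P] := IH W.
have [Wf|Wf] := eqVneq (W *m f) 0.
  exists [seq 0 :: s | s <- L1] => [|u uW].
    rewrite size_map (leq_trans L1s) //; apply: expn_mono => /=; lia.
  have -> : sign_vector (f :: fs) u = 0 :: sign_vector fs u.
    have /submxP[D ->] := uW.
    by rewrite /= /pair_col -mulmxA Wf mulmx0 mxE sgr0.
  by rewrite map_f // L1P.
pose W' := (W :&: kermx f)%MS.
have [L0 L0s L0P] := IH W'.
have W'P u : (u <= W)%MS -> pair_col f u = 0 -> (u <= W')%MS.
  move=> uW fu; rewrite sub_capmx uW /=; apply/sub_kermxP/rowP => i.
  by rewrite !ord1 [RHS]mxE.
have rW' : (\rank W' < \rank W)%N.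
  rewrite ltn_neqAle mxrankS ?capmxSl // andbT.
  apply: contra_neq Wf => /eqP; rewrite (mxrank_leqif_sup (capmxSl _ _)).2.
  by rewrite sub_capmx => /andP[_ /sub_kermxP].
(* If [s] is not realized on the hyperplane, all vectors of [W] with sign vector [s] give [f] the
   same sign, recorded as [g s]. *)
have /choice[g gP] (s : seq R) : exists t, forall u, (u <= W)%MS ->
    sign_vector fs u = s ->
    (exists2 u', (u' <= W')%MS & sign_vector fs u' = s) \/ Num.sg (pair_col f u) = t.
  have [H|H] := pselect (exists2 u', (u' <= W')%MS & sign_vector fs u' = s).
    by exists 0 => u _ _; left.
  have [[u0 u0W u0s]|H'] := pselect (exists2 u, (u <= W)%MS & sign_vector fs u = s).
    exists (Num.sg (pair_col f u0)) => u uW us; right.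
    have f0 v : (v <= W)%MS -> sign_vector fs v = s -> pair_col f v != 0.
      by move=> vW vs; apply/eqP => fv; apply: H; exists v; rewrite ?W'P.
    apply: contrapT => /eqP fne; apply: H.
    have fu := f0 u uW us; have fu0 := f0 u0 u0W u0s.
    (* For opposite signs these positive weights cancel the value of [f], while the other signs are
       kept. *)
    exists (`|pair_col f u| *: u0 + `|pair_col f u0| *: u).
      apply: W'P; first by rewrite addmx_sub ?scalemx_sub.
      rewrite linearD /= !pair_colZ; move: fne.
      have [x|x|/eqP x] := ltgtP (pair_col f u) 0; last by rewrite (negPf fu) in x.
        have [y|y|/eqP y] := ltgtP (pair_col f u0) 0; last by rewrite (negPf fu0) in y.
          by rewrite !ltr0_sg ?eqxx.
        by move=> _; rewrite (ltr0_norm x) (gtr0_norm y); ring.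
      have [y|y|/eqP y] := ltgtP (pair_col f u0) 0; last by rewrite (negPf fu0) in y.
        by move=> _; rewrite (gtr0_norm x) (ltr0_norm y); ring.
      by rewrite !gtr0_sg ?eqxx.
    rewrite -[RHS]u0s; apply/eq_in_map => e efs.
    rewrite linearD /= !pair_colZ sg_combination ?normr_gt0 //.
    have := etrans u0s (esym us) => /eq_in_map/(_ e efs) //.
  by exists 0 => u uW us; exfalso; apply: H'; exists u.
exists ([seq t :: s | s <- L0, t <- [:: 0; 1; -1]] ++ [seq g s :: s | s <- L1]).
  rewrite size_cat size_allpairs size_map /=.
  have -> : \rank W = (\rank W).-1.+1 by rewrite prednK // (leq_ltn_trans _ rW').
  have le1 : (size L0 <= (3 * size fs + 1) ^ (\rank W).-1)%N.
    apply: leq_trans L0s _; rewrite leq_pexp2l //; first by rewrite addn1.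
    by rewrite -ltnS prednK // (leq_ltn_trans _ rW').
  have le2 : (size L1 <= (3 * size fs + 1) ^ (\rank W).-1 * (3 * size fs + 1))%N.
    by rewrite -expnSr prednK // (leq_ltn_trans _ rW').
  rewrite expnSr.
  (* With [m = size fs] and [r] the rank of [W]: three extensions of each vector in [L0] and one of
     each in [L1] give at most [(3 m + 1) ^ (r - 1) * (3 + (3 m + 1))]. *)
  apply: (@leq_trans ((3 * size fs + 1) ^ (\rank W).-1 * (3 * (size fs).+1 + 1)))%N.
    by move: le1 le2; set A := (_ ^ _)%N; nia.
  by rewrite leq_mul2r; apply/orP; right; apply: expn_mono; lia.
move=> u uW; have us := L1P u uW; rewrite mem_cat.
have [[u' u'W us']|fu] := gP _ u uW erefl.
  apply/orP; left; apply/allpairsP; exists (sign_vector fs u, Num.sg (pair_col f u)).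
  split=> //=; first by rewrite -us' L0P.
  by rewrite !inE; case: sgrP; rewrite ?eqxx ?orbT.
apply/orP; right; apply/mapP; exists (sign_vector fs u) => //.
by rewrite -fu.
Qed.

End SignVectors.

(** * Regular subdivisions of a product of simplices *)

Section ProductOfSimplices.
Variables (R : realType) (l k : nat).
Local Notation V := ('I_l.+1 * 'I_k.+1)%type.
Local Notation p := (@prod_simplices_vertex R l k).
Implicit Types (B C : {set V}) (h : V -> R) (alpha : 'I_l.+1 -> R) (beta : 'I_k.+1 -> R).

(** A vertex is the sum of its two components; the constant term goes into [alpha]. *)
Lemma aff_margins (psi : 'cV[R]_(1 + (l.+1 + k.+1))) :
  exists alpha beta, forall v, aff p psi v = alpha v.1 + beta v.2.
Proof.
have [c [t E]] := aff_scalar p psi.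
exists (fun i => c (row_mx (simplex_vertex R i) 0) + t).
exists (fun j => c (row_mx 0 (simplex_vertex R j))) => v.
rewrite E addrAC; congr (_ + _); rewrite -linearD /=; congr (c _).
by rewrite add_row_mx addr0 add0r.
Qed.

Lemma margins_aff alpha beta :
  exists psi, forall v, aff p psi v = alpha v.1 + beta v.2.
Proof.
have [psi E] := scalar_aff p
  (pair_col (col_mx (\col_i alpha i) (\col_j beta j)) : {scalar _}) 0.
exists psi => v; rewrite E addr0 /= /pair_col mul_row_col mxE.
congr (_ + _); rewrite !mxE.
  rewrite (bigD1 v.1) //= big1 => [|i /negPf iv]; rewrite !mxE ?eqxx ?iv ?mul0r //.
  by rewrite mul1r addr0.
rewrite (bigD1 v.2) //= big1 => [|i /negPf iv]; rewrite !mxE ?eqxx ?iv ?mul0r //.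
by rewrite mul1r addr0.
Qed.

Lemma comb_margins (a b : V -> R) alpha beta :
  \sum_v a v *: hpt p v = \sum_v b v *: hpt p v ->
  \sum_v a v * (alpha v.1 + beta v.2) = \sum_v b v * (alpha v.1 + beta v.2).
Proof.
have [psi E] := margins_aff alpha beta => /(aff_comb psi).
by under eq_bigr do rewrite E; under [in RHS]eq_bigr do rewrite E.
Qed.

Lemma prod_cellP B : cell p B <->
  forall alpha beta, (forall v, v \in B -> alpha v.1 + beta v.2 = 0) ->
    forall v : V, alpha v.1 + beta v.2 = 0.
Proof.
split=> [/cellP cB alpha beta H v|H].
  have [psi E] := margins_aff alpha beta; rewrite -E; apply: cB => w wB.
  by rewrite E H.
apply/cellP => psi; have [alpha [beta E]] := aff_margins psi => H0 v.
by rewrite E; apply: H => w wB; rewrite -E H0.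
Qed.

Lemma cell_column B (j : 'I_k.+1) : cell p B -> exists i, (i, j) \in B.
Proof.
move=> /prod_cellP/(_ (fun=> 0) (fun j' => (j' == j)%:R)) H.
apply: contrapT => /forallNP jB.
have /H/(_ (ord0, j))/eqP : forall v : V, v \in B -> 0 + (v.2 == j)%:R = 0 :> R.
  by case=> i j' ijB /=; rewrite add0r; case: eqP => // jj'; case: (jB i); rewrite -jj'.
by rewrite add0r eqxx oner_eq0.
Qed.

(* A cell is a connected bipartite graph. *)
Lemma cell_crossing B (Y : {set 'I_l.+1}) i i' : cell p B -> i \in Y -> i' \notin Y ->
  exists2 x, x \in Y & exists2 x', x' \notin Y & exists j, (x, j) \in B /\ (x', j) \in B.
Proof.
move=> /prod_cellP cB iY i'Y; apply: contrapT => H.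
(* If no column crosses from [Y] to its complement, the indicator of [Y] minus that of the columns
   meeting [Y] vanishes on [B] but not at both [i] and [i'] in column [ord0]. *)
pose beta j : R := - (`[< exists2 x, x \in Y & (x, j) \in B >])%:R.
have /(_ (fun x => (x \in Y)%:R) beta) := cB => /(_ _)/wrap[[x j] xjB /=|E].
  rewrite /beta; have [xY|xY] := boolP (x \in Y).
    by rewrite asboolT ?subrr //; exists x.
  rewrite asboolF ?subrr // => -[y yY yjB].
  by apply: H; exists y => //; exists x => //; exists j.
have := E (i, ord0); have := E (i', ord0); rewrite /= iY (negPf i'Y).
by rewrite add0r => -> /eqP; rewrite addr0 oner_eq0.
Qed.

(** * Slopes of supporting functions as sums of heights along walks *)

Definition coord_form (v : V) : 'cV[R]_#|{: V}| := delta_mx (enum_rank v) 0.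

Definition height_row h : 'rV[R]_#|{: V}| := \row_x h (enum_val x).

Lemma coord_formE v h : pair_col (coord_form v) (height_row h) = h v.
Proof.
rewrite /pair_col mxE (bigD1 (enum_rank v)) //= big1 => [|x /negPf xv].
  by rewrite !mxE !eqxx enum_rankK addr0 mulr1.
by rewrite !mxE xv mulr0.
Qed.

Definition step_form (t : 'I_l.+1 * 'I_l.+1 * 'I_k.+1) :=
  coord_form (t.1.2, t.2) - coord_form (t.1.1, t.2).

(** A step leads from one row to another through a column. Steps from a row to itself are allowed,
    so shorter walks are included. *)
Fixpoint walk_forms (s : nat) : seq 'cV[R]_#|{: V}| :=
  if s is s'.+1 then [seq c + step_form t | c <- walk_forms s', t <- enum {: _}]
  else [:: 0].

(** If the step runs from a tight entry to [(i, j)], and the walks [c.1] and [c.2] lead from row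
    [ord0] to the two rows, this form is the slack at [(i, j)]. *)
Definition slope_forms := [seq step_form t + (c.1 - c.2) |
  c <- [seq (c, c') | c <- walk_forms l, c' <- walk_forms l], t <- enum {: _}].

Lemma size_walk_forms s : size (walk_forms s) = ((l.+1 * l.+1 * k.+1) ^ s)%N.
Proof.
elim: s => //= s IH; rewrite size_allpairs IH -cardE !card_prod !card_ord.
by rewrite expnSr.
Qed.

Lemma size_slope_forms : size slope_forms = ((l.+1 * l.+1 * k.+1) ^ (2 * l).+1)%N.
Proof.
rewrite !size_allpairs !size_walk_forms -cardE !card_prod !card_ord.
by rewrite expnSr -expnD addnn -mul2n.
Qed.

Lemma step_formE t h :
  pair_col (step_form t) (height_row h) = h (t.1.2, t.2) - h (t.1.1, t.2).
Proof. by rewrite pair_colDl pair_colNl !coord_formE. Qed.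

(** Let [Y s] be the rows whose slope is obtained in [s] steps. By connectedness it gains a row at
    each step until it contains all [l.+1] rows, so [l] steps suffice. *)
Lemma walk_forms_reach B h alpha beta : cell p B ->
  (forall v, v \in B -> h v = alpha v.1 + beta v.2) ->
  forall i, exists2 c, c \in walk_forms l &
    pair_col c (height_row h) = alpha i - alpha ord0.
Proof.
move=> cB hB.
pose Y s := [set i | has (fun c => pair_col c (height_row h) == alpha i - alpha ord0)
                         (walk_forms s)]%SET.
have YP s i : reflect (exists2 c, c \in walk_forms s &
    pair_col c (height_row h) = alpha i - alpha ord0) (i \in Y s).
  by rewrite inE; apply: (iffP hasP) => -[c cs /eqP]; exists c => //; apply/eqP.
suff Ys s : (minn s.+1 l.+1 <= #|Y s|)%N.
  have /eqP YT : Y l == [set: 'I_l.+1]%SET.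
    by rewrite eqEcard finset.subsetT cardsT card_ord -{1}(minnn l.+1) Ys.
  by move=> i; apply/YP; rewrite YT inE.
elim: s => [|s IH].
  rewrite (leq_trans (geq_minl _ _)) // card_gt0; apply/finset.set0Pn; exists ord0.
  by apply/YP; exists 0; rewrite ?inE // /pair_col mulmx0 mxE subrr.
have YS : Y s \subset Y s.+1.
  apply/fintype.subsetP => i /YP[c cs ci]; apply/YP; exists c => //.
  apply/allpairsP; exists (c, (ord0, ord0, ord0)); rewrite mem_enum.
  by split=> //=; rewrite /step_form subrr addr0.
have [YT|] := eqVneq (Y s) [set: 'I_l.+1]%SET.
  rewrite (leq_trans (geq_minr _ _)) //.
  by have := subset_leq_card YS; rewrite YT cardsT card_ord.
rewrite finset.eqEsubset finset.subsetT /= => /fintype.subsetPn[i' _ i'Y].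
have : (0 < #|Y s|)%N by apply: leq_trans IH; rewrite leq_min.
rewrite card_gt0 => /finset.set0Pn[i iY].
have [x /YP[c cs cx] [x' x'Y [j [xj x'j]]]] := cell_crossing cB iY i'Y.
have lt : (#|Y s| < #|Y s.+1|)%N.
  apply: proper_card; apply/properP; split=> //; exists x' => //.
  apply/YP; exists (c + step_form (x, x', j)).
    by apply/allpairsP; exists (c, (x, x', j)); rewrite mem_enum.
  by rewrite pair_colDl step_formE cx /= (hB _ xj) (hB _ x'j) /=; ring.
apply: leq_trans lt; apply: (@leq_trans (minn s.+1 l.+1).+1); last by rewrite ltnS.
by lia.
Qed.

(** The walks and tight entries that determine the supporting function for [h] define a candidate
    for [h']. Its slacks are values of the same forms, so they have the same signs. *)
Lemma sign_vector_lower_cells h h' :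
  sign_vector slope_forms (height_row h) = sign_vector slope_forms (height_row h') ->
  lower_cells p h \subset lower_cells p h'.
Proof.
move=> hh'; apply/fintype.subsetP => B /lower_cellsP[cB [psi psih Bt]].
apply/lower_cellsP; split=> //.
have [alpha [beta E]] := aff_margins psi.
have hB v : v \in B -> h v = alpha v.1 + beta v.2.
  by rewrite Bt inE E => /eqP.
have /choice[c cP] i : exists c, c \in walk_forms l /\
    pair_col c (height_row h) = alpha i - alpha ord0.
  by have [c cl ci] := walk_forms_reach cB hB i; exists c.
have /choice[top topP] j := cell_column j cB.
pose alpha' i := pair_col (c i) (height_row h').
have [psi' E'] := margins_aff alpha' (fun j => h' (top j, j) - alpha' (top j)).
have slope i j : Num.sg (h (i, j) - (alpha i + beta j)) =
    Num.sg (h' (i, j) - aff p psi' (i, j)).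
  have : step_form (top j, i, j) + (c (top j) - c i) \in slope_forms.
    apply/allpairsP; exists ((c (top j), c i), (top j, i, j)); split=> //=.
      by apply/allpairsP; exists (c (top j), c i); split=> //=; apply: (cP _).1.
    by rewrite mem_enum.
  move/eq_in_map: hh' => /[apply]; rewrite !(pair_colDl (step_form _)) !step_formE.
  rewrite !(pair_colDl (c _)) !pair_colNl !(cP _).2 E' (hB _ (topP j)) /=.
  rewrite /alpha' => sE; have -> : h (i, j) - (alpha i + beta j) =
      h (i, j) - (alpha (top j) + beta j) +
      (alpha (top j) - alpha ord0 - (alpha i - alpha ord0)) by ring.
  by rewrite sE; congr Num.sg; ring.
exists psi' => [[i j]|].
  rewrite -subr_ge0 -sgr_ge0 -slope sgr_ge0 subr_ge0.
  by have := psih (i, j); rewrite E.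
apply/setP => -[i j]; rewrite Bt !inE E eq_sym -subr_eq0 -sgr_eq0 slope sgr_eq0.
by rewrite subr_eq0 eq_sym.
Qed.

(** A regular subdivision is determined by the sign vector of any heights inducing it; the heights
    form a space of dimension [l.+1 * k.+1]. *)
Lemma card_regular_le : (#|regular_subdivisions p| <=
  (3 * (l.+1 * l.+1 * k.+1) ^ (2 * l).+1 + 1) ^ (l.+1 * k.+1))%N.
Proof.
have [L Ls LP] := count_sign_vectors 1%:M slope_forms.
rewrite size_slope_forms mxrank1 card_prod !card_ord in Ls.
apply: leq_trans Ls.
have /choice[g gP] S : exists h, S \in regular_subdivisions p -> S = lower_cells p h.
  have [|_] := boolP (S \in regular_subdivisions p); last by exists (fun=> 0).
  rewrite inE => /asboolP[dS rS].
  by have [h ->] := regular_lower_cells (ord0, ord0) dS rS; exists h.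
pose code S := sign_vector slope_forms (height_row (g S)).
rewrite cardE -(size_map code); apply: uniq_leq_size.
  rewrite map_inj_in_uniq ?enum_uniq // => S T; rewrite !mem_enum => SR TR ST.
  rewrite (gP _ SR) (gP _ TR); apply/eqP; rewrite finset.eqEsubset.
  by rewrite !sign_vector_lower_cells.
by move=> s /mapP[S _ ->]; apply: LP; rewrite submx1.
Qed.

End ProductOfSimplices.

(** * Lower bound from permutation heights *)

Lemma card_ord_le n (m : 'I_n) : #|[set i : 'I_n | (i <= m)%N]%SET| = m.+1.
Proof.
rewrite -sum1dep_card (eq_bigl (fun i : 'I_n => i < m.+1)%N) //.
by rewrite (big_ord_narrow (ltn_ord m)) sum1_card card_ord.
Qed.

(** The value [s j] is recovered by counting the [i] with [s i <= s j]. *)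
Lemma perm_ord_le_inj n (s t : {perm 'I_n}) :
  (forall i j, (s i <= s j)%N = (t i <= t j)%N) -> s = t.
Proof.
move=> st; apply/permP => j; apply/val_inj/eqP; rewrite -eqSS -!card_ord_le.
rewrite -[X in X == _](card_preimset _ (@perm_inj _ s)).
rewrite -[X in _ == X](card_preimset _ (@perm_inj _ t)).
by apply/eqP/eq_card => i; rewrite !inE st.
Qed.

Section PermutationHeights.
Variables (R : realType) (l k : nat) (l_gt0 : (0 < l)%N).
Local Notation V := ('I_l.+1 * 'I_k.+1)%type.
Local Notation p := (@prod_simplices_vertex R l k).

Definition perm_height (s : {perm 'I_k.+1}) (v : V) : R :=
  if v.1 == ord_max then (s v.2)%:R else 0.

(** The order of the values of [s] can be read off the cells. If both vertices are tight, comparing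
    with the swapped vertices [(ord0, j')] and [(ord_max, j)] gives the inequality; conversely, the
    cell covering the sum of the two vertices contains both. *)
Lemma perm_height_order (s : {perm 'I_k.+1}) (j j' : 'I_k.+1) : (s j' <= s j)%N <->
  exists2 B, B \in lower_cells p (perm_height s) & (ord0, j) \in B /\ (ord_max, j') \in B.
Proof.
have nq : (ord0 == ord_max :> 'I_l.+1) = false by rewrite -val_eqE /= ltn_eqF.
split=> [le_s|[B /lower_cellsP[_ [psi psih ->]]]]; last first.
  have [alpha [beta E]] := aff_margins psi.
  rewrite !inE !E /perm_height /= nq eqxx => -[/eqP H1 /eqP H2].
  have := psih (ord0, j'); have := psih (ord_max, j).
  by rewrite !E /perm_height /= nq eqxx -(@ler_nat R) => H3 H4; lra.
pose a (v : V) : R := (v == (ord0, j))%:R + (v == (ord_max, j'))%:R.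
have sumE (F : V -> R) : \sum_v a v * F v = F (ord0, j) + F (ord_max, j').
  under eq_bigr do rewrite mulrDl; rewrite big_split /=.
  have one w : \sum_v (v == w)%:R * F v = F w.
    rewrite (bigD1 w) //= eqxx mul1r big1 ?addr0 // => v /negPf->.
    by rewrite mul0r.
  by rewrite !one.
have a0 v : 0 <= a v by rewrite addr_ge0.
have [B BL [b [b0 bB bE]]] := lower_cells_cover p (perm_height s) a0.
exists B => //; have [_ [psi psih Bt]] := lower_cellsP _ _ _ BL.
have bcol v : v.2 != j -> v.2 != j' -> b v = 0.
  move=> vj vj'; have := comb_margins (fun=> 0) (fun j => (j == v.2)%:R) bE.
  rewrite sumE /= add0r eq_sym (negPf vj) [j' == _]eq_sym (negPf vj') !add0r.
  have b'0 w : xpredT w -> 0 <= b w * (0 + (w.2 == v.2)%:R) by rewrite add0r mulr_ge0.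
  move=> /(psumr_eq0P b'0)/(_ v isT); rewrite eqxx add0r mulr1 //.
(* Both combinations put total weight 1 on the last row. The weights [b] live in columns [j] and
   [j'], where the last row has height at least [s j'], so [a] is no more expensive than [b], which
   is tight. *)
have le_sum : \sum_v a v * perm_height s v <= \sum_v b v * perm_height s v.
  have := comb_margins (fun i => (i == ord_max)%:R * (s j')%:R) (fun=> 0) bE.
  rewrite !sumE /perm_height /= nq eqxx mul1r mul0r !addr0 => <-.
  apply: ler_sum => -[i j0] _ /=; rewrite addr0.
  have [->|j0j] := eqVneq j0 j.
    case: eqP => _; rewrite ?mul0r ?mulr0 // mul1r ler_wpM2l // ler_nat //.
  have [->|j0j'] := eqVneq j0 j'; first by case: eqP; rewrite ?mul1r ?mul0r.
  by rewrite (bcol (i, j0)) // !mul0r.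
have aD v : 0 <= a v * (perm_height s v - aff p psi v) by rewrite mulr_ge0 ?subr_ge0.
have S0 : \sum_v a v * (perm_height s v - aff p psi v) = 0.
  apply/eqP; rewrite eq_le sumr_ge0 // andbT.
  under eq_bigr do rewrite mulrBr; rewrite sumrB subr_le0.
  rewrite (le_trans le_sum) // -(aff_comb psi bE) le_eqVlt; apply/orP; left; apply/eqP.
  apply: eq_bigr => v _; have [|/bB->] := boolP (v \in B); last by rewrite !mul0r.
  by rewrite Bt inE => /eqP->.
have tightP v : a v != 0 -> v \in B.
  move=> av; have /(_ v isT) := psumr_eq0P (fun w _ => aD w) S0.
  by move/eqP; rewrite mulf_eq0 (negPf av) subr_eq0 eq_sym Bt inE.
split; apply: tightP; rewrite /a eqxx xpair_eqE ?nq ?addr0 ?oner_neq0 //.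
by rewrite [ord_max == _]eq_sym nq add0r oner_neq0.
Qed.

Lemma card_regular_ge : (k.+1`! <= #|regular_subdivisions p|)%N.
Proof.
rewrite -card_Sn -cardsT.
rewrite -(@card_imset _ _ (fun s : {perm 'I_k.+1} => lower_cells p (perm_height s))).
  apply: subset_leq_card; apply/fintype.subsetP => _ /imsetP[s _ ->].
  rewrite inE; apply/asboolP; split; first exact: lower_cells_subdivision.
  exact: is_regular_lower_cells.
move=> s t st; apply: perm_ord_le_inj => i j; apply/idP/idP.
  by move=> /perm_height_order; rewrite st => /perm_height_order.
by move=> /perm_height_order; rewrite -st => /perm_height_order.
Qed.

End PermutationHeights.

(** * Flipping hexagons *)

Lemma poly_nat_nonroot (R : realFieldType) (q : {poly R}) (m : nat) : q != 0 ->
  exists2 i, (m <= i)%N & q.[i%:R] != 0.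
Proof.
move=> q0; apply: contrapT => H.
suff /(max_poly_roots q0) : all (root q) [seq i%:R | i <- iota m (size q)].
  rewrite size_map size_iota ltnn => /(_ _)/wrap[|//].
  by rewrite map_inj_uniq ?iota_uniq // => i j /eqP; rewrite eqr_nat => /eqP.
apply/allP => _ /mapP[i + ->]; rewrite mem_iota => /andP[mi _].
by apply: contrapT => qi; apply: H; exists i => //; apply/negP.
Qed.

Lemma eq0_pair_col (R : realFieldType) n (x : 'rV[R]_n) :
  (forall D, pair_col D x = 0) -> x = 0.
Proof.
move=> H; apply/rowP => i; have := H (delta_mx i 0).
rewrite /pair_col mxE (bigD1 i) //= big1 => [|j /negPf ji]; rewrite !mxE ?eqxx ?ji.
  by rewrite mulr1 addr0.
by rewrite mulr0.
Qed.

Section Hexagons.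
Variables (R : realType) (l k n : nat).
Hypotheses (l_ge2 : (2 <= l)%N) (n_le : (4 * n <= k.+1)%N).
Local Notation V := ('I_l.+1 * 'I_k.+1)%type.
Local Notation p := (@prod_simplices_vertex R l k).
Implicit Types (B C : {set V}) (t : 'I_n * 'I_n) (E : {set 'I_n * 'I_n}).

(* In a column [j < 4 * n] the rows [lo j] and [hi j] have heights [0] and
   [gap j]; all the other heights are generic.  The columns form three families,
   for the pairs of rows (0, 1), (2, 0) and (2, 1). *)
Definition lo (j : nat) : nat := (if j < n then 0 else 2)%N.
Definition hi (j : nat) : nat := (if j < n then 1 else if j < 2 * n then 0 else 1)%N.
Definition gap (j : nat) : nat :=
  (if j < n then j else if j < 2 * n then j - n else j - 2 * n)%N.

Definition special (v : V) : bool :=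
  (v.2 < 4 * n)%N && ((nat_of_ord v.1 == lo v.2) || (nat_of_ord v.1 == hi v.2)).

(** Distinct positive powers of [x] keep the generic heights from cancelling against each other or
    against the constant special heights. *)
Definition grid_height (x : R) (v : V) : R :=
  if special v then (if nat_of_ord v.1 == lo v.2 then 0 else (gap v.2)%:R)
  else x ^+ (enum_rank v).+1.

(* For a label set carrying dependencies that do not vanish on the generic
   vertices, fix one of them: its pairing with the heights is a nonzero polynomial
   in [x], whereas on a tight set every such pairing vanishes.  So [x] only has to
   avoid the roots of finitely many polynomials. *)
Lemma grid_height_generic : exists2 x : R, 2 * n%:R + 1 <= x &
  forall C, C \in lower_cells p (grid_height x) ->
  forall a : V -> R, (forall v, v \notin C -> a v = 0) ->
    \sum_v a v *: hpt p v = 0 -> forall v, ~~ special v -> a v = 0.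
Proof.
pose bad (F : {set V}) (a : V -> R) := [/\ forall v, v \notin F -> a v = 0,
  \sum_v a v *: hpt p v = 0 & exists2 v, ~~ special v & a v != 0].
have /choice[f fP] F : exists a, (exists b, bad F b) -> bad F a.
  by have [[b bF]|nb] := pselect (exists b, bad F b); [exists b|exists (fun=> 0)].
pose q F : {poly R} := \sum_v f F v *:
  (if special v then ((if nat_of_ord v.1 == lo v.2 then 0 else (gap v.2)%:R) : R)%:P
   else 'X^((enum_rank v).+1)).
have qE F x : (q F).[x] = \sum_v f F v * grid_height x v.
  rewrite horner_sum; apply: eq_bigr => v _; rewrite hornerZ /grid_height.
  by case: ifP => _; rewrite ?hornerC ?hornerXn.
have q0 F : bad F (f F) -> q F != 0.
  case=> _ _ [w ws fw]; apply: contra_neq fw => qF.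
  have /polyP/(_ (enum_rank w).+1) := qF; rewrite coef0 coef_sum => <-.
  rewrite (bigD1 w) //= (negPf ws) coefZ coefXn eqxx mulr1 big1 ?addr0 // => v vw.
  rewrite coefZ; case: ifP => _; first by rewrite coefC mulr0.
  by rewrite coefXn eqSS (inj_eq val_inj) (inj_eq enum_rank_inj) eq_sym (negPf vw) mulr0.
pose Q := \prod_(F : {set V} | `[< bad F (f F) >]) q F.
have Q0 : Q != 0 by apply/prodf_neq0 => F /asboolP/q0.
(* The bound [2 * n + 1] keeps the generic heights above the functions that will support the
   hexagons. *)
have [i le_i Qi] := poly_nat_nonroot (2 * n + 1) Q0.
exists i%:R; first by move: le_i; rewrite -(ler_nat R) natrD natrM.
move=> C CL a aC a0 v vs; apply/eqP; apply: contraPT CL => av.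
have badC : bad C (f C) by apply: fP; exists a; split=> //; exists v.
move=> /lower_cellsP[_ [psi _ Ct]].
have : (q C).[i%:R] != 0.
  apply: contraNneq Qi => qi; rewrite horner_prod; apply/prodf_eq0.
  by exists C; [apply/asboolP|rewrite qi].
have [fC f0 _] := badC.
rewrite qE (eq_bigr (fun v => f C v * aff p psi v)) => [|w _].
  by rewrite -pair_col_comb f0 linear0 eqxx.
have [|/fC->] := boolP (w \in C); last by rewrite !mul0r.
by rewrite {1}Ct inE => /eqP->.
Qed.

(** * The hexagons and their affine dependencies *)

Definition vtx (i j : nat) : V := (inord i, inord j).
Arguments vtx : simpl never.

Lemma eq_vtx (v : V) i j : (i <= 2)%N -> (j < 4 * n)%N ->
  (v == vtx i j) = (nat_of_ord v.1 == i) && (nat_of_ord v.2 == j).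
Proof.
move=> i2 jn; case: v => v1 v2; rewrite /vtx xpair_eqE -!val_eqE /= !inordK //.
  exact: leq_trans n_le.
by rewrite ltnS (leq_trans i2).
Qed.

Lemma vtxK1 i j : (i <= 2)%N -> (vtx i j).1 = i :> nat.
Proof. by move=> i2; rewrite /vtx /= inordK // ltnS (leq_trans i2). Qed.

Lemma vtxK2 i j : (j < 4 * n)%N -> (vtx i j).2 = j :> nat.
Proof. by move=> jn; rewrite /vtx /= inordK // (leq_trans jn). Qed.

(** The three columns have gaps [t.1], [t.2] and [t.1 + t.2]. As the third is the sum of the others,
    one choice of row slopes makes all six lifted vertices tight. *)
Definition colA t : nat := t.1.
Definition colB t : nat := (n + t.2)%N.
Definition colC t : nat := (2 * n + (t.1 + t.2))%N.

Lemma colP t : [/\ (colA t < n)%N, (n <= colB t < 2 * n)%N & (2 * n <= colC t < 4 * n)%N].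
Proof.
have := ltn_ord t.1; have := ltn_ord t.2; rewrite /colA /colB /colC => ? ?.
by split; lia.
Qed.

Lemma colAE t : [/\ (colA t < 4 * n)%N, lo (colA t) = 0%N, hi (colA t) = 1%N &
  gap (colA t) = t.1].
Proof. by have [cA _ _] := colP t; rewrite /lo /hi /gap cA; split=> //; lia. Qed.

Lemma colBE t : [/\ (colB t < 4 * n)%N, lo (colB t) = 2%N, hi (colB t) = 0%N &
  gap (colB t) = t.2].
Proof.
have [_ /andP[c1 c2] _] := colP t; have c3 : (colB t < n)%N = false by lia.
by rewrite /lo /hi /gap c3 c2 /colB addKn; split=> //; move: c2; rewrite /colB; lia.
Qed.

Lemma colCE t : [/\ (colC t < 4 * n)%N, lo (colC t) = 2%N, hi (colC t) = 1%N &
  gap (colC t) = (t.1 + t.2)%N].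
Proof.
have [_ _ /andP[c1 c2]] := colP t; have c3 : (colC t < n)%N = false by lia.
have c4 : (colC t < 2 * n)%N = false by lia.
by rewrite /lo /hi /gap c3 c4 c2 /colC addKn.
Qed.

(** The vertices of the 6-cycle, taken alternately: each of its rows and columns meets [plus t] once
    and [minus t] once, so [hex_sign] is an affine dependency. *)
Definition plus t : seq V := [:: vtx 0 (colA t); vtx 2 (colB t); vtx 1 (colC t)].
Definition minus t : seq V := [:: vtx 1 (colA t); vtx 0 (colB t); vtx 2 (colC t)].
Definition hex t : {set V} := [set v in plus t ++ minus t]%SET.

Definition hex_sign t (v : V) : R :=
  \sum_(w <- plus t) (v == w)%:R - \sum_(w <- minus t) (v == w)%:R.

Lemma sum_delta (s : seq V) (F : V -> R) :
  \sum_v (\sum_(w <- s) (v == w)%:R) * F v = \sum_(w <- s) F w.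
Proof.
under eq_bigr do rewrite mulr_suml; rewrite exchange_big; apply: eq_bigr => w _.
rewrite (bigD1 w) //= eqxx mul1r big1 ?addr0 // => v /negPf->.
by rewrite mul0r.
Qed.

Lemma sum_hex_sign t (F : V -> R) :
  \sum_v hex_sign t v * F v = \sum_(w <- plus t) F w - \sum_(w <- minus t) F w.
Proof.
by under eq_bigr do rewrite mulrBl; rewrite sumrB !sum_delta.
Qed.

Lemma hex_sign_dependency t : \sum_v hex_sign t v *: hpt p v = 0.
Proof.
apply: eq0_pair_col => psi; rewrite pair_col_comb.
have [alpha [beta E]] := aff_margins psi.
rewrite sum_hex_sign !big_cons !big_nil !E /=; ring.
Qed.

Lemma hex_signE t v : [/\ v \in plus t -> hex_sign t v = 1,
  v \in minus t -> hex_sign t v = -1 & v \notin hex t -> hex_sign t v = 0].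
Proof.
have [a b c] := colP t; rewrite /hex_sign !big_cons !big_nil !inE !addr0.
rewrite !eq_vtx //; try lia.
case: v => i j /=; move: (nat_of_ord i) (nat_of_ord j) => {}i {}j.
have [->|Aj] := eqVneq j (colA t).
  have -> : (colA t == colB t) = false by lia.
  have -> : (colA t == colC t) = false by lia.
  rewrite !andbF !andbT !orbF /=.
  have [->|_] /= := eqVneq i 0%N; first by split=> //; rewrite ?addr0 ?subr0.
  have [_|_] /= := eqVneq i 1%N; first by split=> //; rewrite ?addr0 ?add0r.
  by split=> // _; rewrite !addr0 subr0.
have [->|Bj] := eqVneq j (colB t).
  have -> : (colB t == colC t) = false by lia.
  rewrite !andbF !andbT !orbF /=.
  have [->|_] /= := eqVneq i 2%N; first by split=> //; rewrite ?addr0 ?add0r ?subr0.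
  have [_|_] /= := eqVneq i 0%N; first by split=> //; rewrite ?addr0 ?add0r.
  by split=> // _; rewrite !addr0 subr0.
rewrite !andbF /=; have [_|_] := eqVneq j (colC t).
  rewrite !andbT; have [->|_] /= := eqVneq i 1%N.
    by split=> //; rewrite ?addr0 ?add0r ?subr0.
  have [_|_] /= := eqVneq i 2%N; first by split=> //; rewrite ?addr0 ?add0r.
  by split=> // _; rewrite !addr0 subr0.
by rewrite !andbF; split=> // _; rewrite !addr0 subr0.
Qed.

Lemma hex_sub t C : hex t \subset C ->
  [/\ vtx (lo (colA t)) (colA t) \in C, vtx (hi (colA t)) (colA t) \in C,
      vtx (lo (colB t)) (colB t) \in C & vtx (hi (colB t)) (colB t) \in C].
Proof.
have [_ -> -> _] := colAE t; have [_ -> -> _] := colBE t.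
by move=> /fintype.subsetP tC; split; apply: tC; rewrite !inE eqxx ?orbT.
Qed.

(** * Hexagons in the lower cells of the generic heights *)

Section Generic.
Variable x : R.
Hypothesis x_generic : forall C, C \in lower_cells p (grid_height x) ->
  forall a : V -> R, (forall v, v \notin C -> a v = 0) ->
    \sum_v a v *: hpt p v = 0 -> forall v, ~~ special v -> a v = 0.

Lemma lo_neq_hi j : lo j != hi j.
Proof. by rewrite /lo /hi; case: ltnP => // _; case: ltnP. Qed.

Lemma lo_le2 j : (lo j <= 2)%N. Proof. by rewrite /lo; case: ifP. Qed.
Lemma hi_le2 j : (hi j <= 2)%N. Proof. by rewrite /hi; do 2?case: ifP. Qed.

Lemma grid_height_lo j : (j < 4 * n)%N -> grid_height x (vtx (lo j) j) = 0.
Proof.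
by move=> jn; rewrite /grid_height /special !vtxK1 ?lo_le2 // !vtxK2 // jn eqxx.
Qed.

Lemma grid_height_hi j : (j < 4 * n)%N -> grid_height x (vtx (hi j) j) = (gap j)%:R.
Proof.
move=> jn; rewrite /grid_height /special !vtxK1 ?hi_le2 // !vtxK2 // jn eqxx orbT /=.
by rewrite eq_sym (negPf (lo_neq_hi j)).
Qed.

Lemma gap_slope C : C \in lower_cells p (grid_height x) -> exists alpha : nat -> R,
  forall j, (j < 4 * n)%N -> vtx (lo j) j \in C -> vtx (hi j) j \in C ->
    alpha (hi j) - alpha (lo j) = (gap j)%:R.
Proof.
move=> /lower_cellsP[_ [psi _ ->]]; have [alpha [beta E]] := aff_margins psi.
exists (fun i => alpha (inord i)) => j jn; rewrite !inE !E.
rewrite grid_height_lo // grid_height_hi //= => /eqP H1 /eqP H2.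
by rewrite -H2 -[LHS]addr0 -H1; ring.
Qed.

Lemma hex_slope C t : C \in lower_cells p (grid_height x) -> hex t \subset C ->
  exists2 alpha : nat -> R,
   (forall j, (j < 4 * n)%N -> vtx (lo j) j \in C -> vtx (hi j) j \in C ->
    alpha (hi j) - alpha (lo j) = (gap j)%:R) &
   alpha 1%N - alpha 0%N = (nat_of_ord t.1)%:R /\ alpha 0%N - alpha 2%N = (nat_of_ord t.2)%:R.
Proof.
move=> CL /hex_sub[tA tA' tB tB']; have [alpha alphaE] := gap_slope CL.
exists alpha => //; have [A4 lA hA gA] := colAE t; have [B4 lB hB gB] := colBE t.
have := alphaE _ A4 tA tA'; have := alphaE _ B4 tB tB'.
by rewrite lA lB hA hB gA gB => -> ->.
Qed.

(** The slopes of the supporting function between rows 0, 1 and 2 are [t.1] and [t.2], so the cell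
    determines [t]. *)
Lemma hex_uniq C t t' : C \in lower_cells p (grid_height x) ->
  hex t \subset C -> hex t' \subset C -> t = t'.
Proof.
move=> CL /hex_sub[tA tA' tB tB'] /(hex_slope CL)[alpha alphaE [e1 e2]].
have [A4 lA hA gA] := colAE t; have [B4 lB hB gB] := colBE t.
have := alphaE _ A4 tA tA'; have := alphaE _ B4 tB tB'.
rewrite lA lB hA hB gA gB e1 e2 => /eqP; rewrite eqr_nat => /eqP E2 /eqP.
rewrite eqr_nat => /eqP E1; apply/eqP; rewrite -pair_eqE /pair_eq -!val_eqE /=.
by apply/andP; split; apply/eqP; rewrite ?E2 // -E1.
Qed.

Lemma special_vtx v : special v -> (v.2 < 4 * n)%N /\
  (v = vtx (lo v.2) v.2 \/ v = vtx (hi v.2) v.2).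
Proof.
case/andP=> jn /orP[]/eqP iv; split=> //; [left|right]; apply/eqP.
  by rewrite eq_vtx ?lo_le2 // iv !eqxx.
by rewrite eq_vtx ?hi_le2 // iv !eqxx.
Qed.

(** Genericity leaves at most two vertices per column, with opposite coefficients; the slopes leave
    only the three columns of the hexagon; the row sums leave one parameter. *)
Lemma hex_dependency C t (a : V -> R) : C \in lower_cells p (grid_height x) ->
  hex t \subset C -> (forall v, v \notin C -> a v = 0) ->
  \sum_v a v *: hpt p v = 0 -> exists s, forall v, a v = s * hex_sign t v.
Proof.
move=> CL tC aC a0.
have asp := x_generic CL aC a0.
have marg (alpha : 'I_l.+1 -> R) (beta : 'I_k.+1 -> R) :
    \sum_v a v * (alpha v.1 + beta v.2) = 0.
  have [psi E] := margins_aff alpha beta.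
  under eq_bigr do rewrite -E.
  by rewrite -pair_col_comb a0 linear0.
have col0 j : (j < 4 * n)%N -> a (vtx (hi j) j) = - a (vtx (lo j) j).
  move=> jn; apply/eqP; rewrite -addr_eq0; apply/eqP.
  have := marg (fun=> 0) (fun j' => (nat_of_ord j' == j)%:R).
  have ne : vtx (lo j) j != vtx (hi j) j.
    by rewrite eq_vtx ?hi_le2 // vtxK1 ?lo_le2 // (negPf (lo_neq_hi j)).
  rewrite (bigD1 (vtx (hi j) j)) //= (bigD1 (vtx (lo j) j)) //= big1 => [|v /andP[vh vl]].
    by rewrite !add0r vtxK2 // eqxx !mulr1 addr0.
  have [vj|] := eqVneq (nat_of_ord v.2) j; last by rewrite addr0 mulr0.
  rewrite asp ?mul0r //; apply/negP => /special_vtx[_]; rewrite vj => -[]/eqP.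
    by rewrite (negPf vl).
  by rewrite (negPf vh).
have [alpha alphaE [e1 e2]] := hex_slope CL tC.
have [cA cB cC] := colP t.
(* A nonzero coefficient puts both special vertices of the column in [C], so its gap equals the
   slope. Within each family the gap determines the column. *)
have lo0 j : (j < 4 * n)%N -> j \notin [:: colA t; colB t; colC t] -> a (vtx (lo j) j) = 0.
  move=> jn jt; apply/eqP; apply: contraNT jt => aj.
  have lC : vtx (lo j) j \in C by apply: contraNT aj => /aC->.
  have hC : vtx (hi j) j \in C.
    by apply: contraNT aj => /aC/eqP; rewrite col0 // oppr_eq0.
  have := alphaE _ jn lC hC; rewrite /lo /hi /gap !inE.
  case: ltnP => j1; first by rewrite e1 => /eqP; rewrite eqr_nat => /eqP <-; rewrite eqxx.
  case: ltnP => j2.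
    rewrite e2 => /eqP; rewrite eqr_nat => /eqP E2.
    by apply/orP; right; apply/orP; left; rewrite /colB; lia.
  have -> : alpha 1%N - alpha 2%N = (nat_of_ord t.1 + nat_of_ord t.2)%:R.
    by rewrite natrD -e1 -e2; ring.
  move=> /eqP; rewrite eqr_nat => /eqP E2.
  by apply/orP; right; apply/orP; right; rewrite /colC; lia.
have [A4 loA hiA _] := colAE t; have [B4 loB hiB _] := colBE t.
have [C4 loC hiC _] := colCE t.
have [sA sB sC] : [/\ a (vtx 1 (colA t)) = - a (vtx 0 (colA t)),
    a (vtx 0 (colB t)) = - a (vtx 2 (colB t)) & a (vtx 1 (colC t)) = - a (vtx 2 (colC t))].
  have := col0 _ A4; have := col0 _ B4; have := col0 _ C4.
  by rewrite loA loB loC hiA hiB hiC.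
have supp v : v \notin hex t -> a v = 0.
  move=> vt; have [/special_vtx[jn vE]|/asp//] := boolP (special v).
  have jt : nat_of_ord v.2 \notin [:: colA t; colB t; colC t].
    apply: contra vt; rewrite !inE => /or3P[]/eqP jE; move: vE; rewrite jE.
    - by rewrite loA hiA => -[]->; rewrite eqxx ?orbT.
    - by rewrite loB hiB => -[]->; rewrite eqxx ?orbT.
    - by rewrite loC hiC => -[]->; rewrite eqxx ?orbT.
  by case: vE => ->; rewrite ?col0 // lo0 ?oppr0.
have uh : uniq (plus t ++ minus t).
  by rewrite /= !inE !eq_vtx // !vtxK1 // !vtxK2 // /= ?andbT !orbF; lia.
have sumE (F : V -> R) : \sum_v a v * F v = \sum_(v <- plus t ++ minus t) a v * F v.
  rewrite (bigID (mem (hex t))) /= [X in _ + X]big1 => [|v /supp->]; last by rewrite mul0r.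
  by rewrite addr0 big_uniq //=; apply: eq_bigl => v; rewrite inE.
have r1 := marg (fun i => (nat_of_ord i == 1%N)%:R) (fun=> 0).
have r2 := marg (fun i => (nat_of_ord i == 2%N)%:R) (fun=> 0).
move: r1 r2; rewrite !sumE !big_cons !big_nil !vtxK1 //= sA sB sC => r1 r2.
have eB : a (vtx 2 (colB t)) = a (vtx 0 (colA t)) by move: r1 r2; lra.
have eC : a (vtx 2 (colC t)) = - a (vtx 0 (colA t)) by move: r1 r2; lra.
exists (a (vtx 0 (colA t))) => v.
have [h1 h2 h3] := hex_signE t v.
have [vt|vt] := boolP (v \in hex t); last by rewrite supp // h3 // mulr0.
move: (vt); rewrite inE mem_cat => /orP[vp|vm].
  rewrite h1 // mulr1; move: vp; rewrite !inE => /or3P[]/eqP-> //.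
  by rewrite sC eC opprK.
rewrite h2 // mulrN1; move: vm; rewrite !inE => /or3P[]/eqP-> //.
by rewrite sB eB.
Qed.

(** An explicit affine function below the heights is tight on the hexagon, and its tight set is
    grown to a cell. *)
Lemma hex_in_lower_cell t : 2 * n%:R + 1 <= x ->
  exists2 C, C \in lower_cells p (grid_height x) & hex t \subset C.
Proof.
move=> x_large.
pose alpha (i : nat) : R := if i == 1%N then (nat_of_ord t.1)%:R
  else if i == 2%N then - (nat_of_ord t.2)%:R else 0.
(* In each column with special vertices, the largest value that they allow; both are tight exactly
   when the gap equals the slope. *)
pose beta (j : nat) : R :=
  if (j < 4 * n)%N then Num.min (- alpha (lo j)) ((gap j)%:R - alpha (hi j)) else 0.
have t1 : (nat_of_ord t.1)%:R <= n%:R :> R by rewrite ler_nat ltnW.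
have t2 : (nat_of_ord t.2)%:R <= n%:R :> R by rewrite ler_nat ltnW.
have n0 : 0 <= n%:R :> R by [].
have [psi psiE] := margins_aff (fun i : 'I_l.+1 => alpha i) (fun j : 'I_k.+1 => beta j).
have alpha_le i : alpha i <= n%:R.
  rewrite /alpha; case: ifP => // _; case: ifP => // _.
  by apply: le_trans n0; rewrite oppr_le0.
have beta_le j : beta j <= n%:R.
  rewrite /beta; case: ifP => // _; rewrite ge_min; apply/orP; left.
  by rewrite /lo; case: (ltnP j n) => _; rewrite /alpha /= ?oppr0 ?opprK.
have psih v : aff p psi v <= grid_height x v.
  rewrite psiE /grid_height; case: ifPn => [/andP[jn]|_].
    rewrite /beta jn; have [->|_ /=] := eqVneq (nat_of_ord v.1) (lo v.2).
      by move=> _; rewrite -lerBrDl sub0r ge_min lexx.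
    by move=> /eqP->; rewrite -lerBrDl ge_min lexx orbT.
  have x1 : 1 <= x by move: x_large n0; set y := n%:R; lra.
  apply: (@le_trans _ _ x).
    by move: x_large n0 (alpha_le v.1) (beta_le v.2); set y := n%:R; lra.
  by rewrite exprS ler_peMr ?exprn_ege1 ?(le_trans ler01).
(* The weights are 0 because only the inclusion of tight sets matters here. *)
have [chi [chih chic _ sub]] := grow_to_cell (fun _ => lexx (0 : R)) psih.
exists (tight p (grid_height x) chi).
  by apply/lower_cellsP; split=> //; exists chi.
apply: fintype.subset_trans sub.
have tightP j : (j < 4 * n)%N -> alpha (hi j) - alpha (lo j) = (gap j)%:R ->
    (vtx (lo j) j \in tight p (grid_height x) psi) &&
    (vtx (hi j) j \in tight p (grid_height x) psi).
  move=> jn aj; rewrite !inE !psiE grid_height_lo // grid_height_hi //.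
  rewrite !vtxK1 ?lo_le2 ?hi_le2 // !vtxK2 // /beta jn -aj.
  have -> : alpha (hi j) - alpha (lo j) - alpha (hi j) = - alpha (lo j) by ring.
  by rewrite minxx subrr !eqxx.
have [A4 lA hA gA] := colAE t; have [B4 lB hB gB] := colBE t.
have [C4 lC hC gC] := colCE t.
have /andP[A0 A1] : (vtx 0 (colA t) \in tight p (grid_height x) psi) &&
    (vtx 1 (colA t) \in tight p (grid_height x) psi).
  by have := tightP _ A4; rewrite lA hA gA /alpha /= subr0; apply.
have /andP[B2 B0] : (vtx 2 (colB t) \in tight p (grid_height x) psi) &&
    (vtx 0 (colB t) \in tight p (grid_height x) psi).
  by have := tightP _ B4; rewrite lB hB gB /alpha /= sub0r opprK; apply.
have /andP[C2 C1] : (vtx 2 (colC t) \in tight p (grid_height x) psi) &&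
    (vtx 1 (colC t) \in tight p (grid_height x) psi).
  by have := tightP _ C4; rewrite lC hC gC /alpha /= opprK natrD; apply.
apply/fintype.subsetP => v; rewrite [v \in hex t]inE mem_cat !in_cons !in_nil !orbF.
by move=> /orP[/or3P|/or3P] [] /eqP->.
Qed.

(* All the cells around a hexagon are refined in the same way, since the hexagon
   may be a face of several cells when [l > 2]. *)
Definition flips E B : {set {set V}} :=
  if [pick t in E | hex t \subset B] is Some t then [set [set e]%SET | e in plus t]%SET
  else [set finset.set0]%SET.

Variant flips_spec E B (X : {set V}) : Prop :=
  | FlipsNone of X = finset.set0 & forall t, t \in E -> ~~ (hex t \subset B)
  | FlipsSome t e of t \in E & hex t \subset B & e \in plus t & X = [set e]%SET.

Lemma flipsP E B X : X \in flips E B -> flips_spec E B X.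
Proof.
rewrite /flips; case: pickP => [t /andP[tE tB]|noE].
  by case/imsetP => e ep ->; exact: FlipsSome tE tB ep erefl.
rewrite finset.in_set1 => /eqP->; apply: FlipsNone => // t tE.
by have := noE t; rewrite /= tE /= => ->.
Qed.

Lemma plus_hex t v : v \in plus t -> v \in hex t.
Proof. by move=> vp; rewrite inE mem_cat vp. Qed.

Lemma hex_sign_neq0 t v : v \in hex t -> hex_sign t v != 0.
Proof.
have [h1 h2 _] := hex_signE t v; rewrite inE mem_cat => /orP[/h1->|/h2->].
  exact: oner_neq0.
by rewrite oppr_eq0 oner_neq0.
Qed.

(** The dependency of the hexagon has coefficient 1 at the deleted vertex, so an affine function
    vanishing on the other vertices vanishes there too. *)
Lemma flips_cell E B X : B \in lower_cells p (grid_height x) -> X \in flips E B ->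
  cell p (B :\: X)%SET.
Proof.
move=> /lower_cellsP[cB _] /flipsP[->|t e tE tB ep ->]; first by rewrite finset.setD0.
apply/cellP => psi psi0; apply: ((cellP p B).1 cB psi) => v vB.
have [->|ve] := eqVneq v e; last by apply: psi0; rewrite finset.in_setD finset.in_set1 ve.
have := pair_col_comb p psi (hex_sign t); rewrite hex_sign_dependency linear0.
have [-> // _ _] := hex_signE t e; rewrite (bigD1 e) //= big1 => [|w we].
  by have [-> // _ _] := hex_signE t e; rewrite mul1r addr0 => <-.
have [wt|wt] := boolP (w \in hex t).
  rewrite psi0 ?mulr0 // finset.in_setD finset.in_set1 we.
  exact: (fintype.subsetP tB).
by have [_ _ -> //] := hex_signE t w; rewrite mul0r.
Qed.

(* Subtract from a convex combination the largest possible multiple of the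
   affine dependency of the hexagon. *)
Lemma flips_cover E B y : hull p B y ->
  exists2 X, X \in flips E B & hull p (B :\: X)%SET y.
Proof.
move=> yB; rewrite /flips; case: pickP => [t /andP[tE tB]|_]; last first.
  by exists finset.set0; [rewrite finset.set11|rewrite finset.setD0].
case/hullP: yB => a [a0 aB ay].
have A0p : mem (plus t) (vtx 0 (colA t)) by rewrite /= inE eqxx.
case: (@arg_minP _ _ _ _ (mem (plus t)) a A0p) => e ep emin.
exists [set e]%SET; first by apply/imsetP; exists e.
apply/hullP; exists (fun v => a v - a e * hex_sign t v); split=> [v|v|].
- have [h1 h2 h3] := hex_signE t v.
  have [|vt] := boolP (v \in hex t); last by rewrite h3 // mulr0 subr0.
  rewrite inE mem_cat => /orP[vp|vm].
    by rewrite h1 // mulr1 subr_ge0; apply: emin.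
  by rewrite h2 // mulrN1 opprK addr_ge0.
- rewrite finset.in_setD finset.in_set1 negb_and negbK => /orP[/eqP->|vB].
    by have [-> // _ _] := hex_signE t e; rewrite mulr1 subrr.
  have [_ _ -> //] := hex_signE t v; first by rewrite mulr0 subr0 aB.
  by apply: contra vB; apply: (fintype.subsetP tB).
under eq_bigr do rewrite scalerBl -scalerA.
by rewrite sumrB -scaler_sumr hex_sign_dependency scaler0 subr0.
Qed.

(** By [affine_extension] it suffices to test dependencies supported in both cells. If only one cell
    contains its flipped hexagon, they vanish. If both do, it is the same hexagon, and the two
    deleted vertices have equal coefficients. *)
Lemma flips_affine E B C X Y :
  B \in lower_cells p (grid_height x) -> C \in lower_cells p (grid_height x) ->
  X \in flips E B -> Y \in flips E C ->
  exists psi, forall v, v \in B -> v \in C -> aff p psi v = (v \in X)%:R - (v \in Y)%:R.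
Proof.
move=> BL CL XB YC.
suff [psi psiE] : exists psi, forall v, v \in (B :&: C)%SET ->
    aff p psi v = (v \in X)%:R - (v \in Y)%:R.
  by exists psi => v vB vC; rewrite psiE // finset.in_setI vB.
apply: affine_extension => a aBC a0.
have aB v : v \notin B -> a v = 0.
  by move=> /negPf vB; apply: aBC; rewrite finset.in_setI vB.
have aC v : v \notin C -> a v = 0.
  by move=> /negPf vC; apply: aBC; rewrite finset.in_setI vC andbF.
have sum_set1 e : \sum_v a v * (v \in [set e]%SET)%:R = a e.
  rewrite (bigD1 e) //= finset.set11 mulr1 big1 ?addr0 // => v /negPf ve.
  by rewrite finset.in_set1 ve mulr0.
have vanish t (D D' : {set V}) : D \in lower_cells p (grid_height x) -> hex t \subset D ->
    ~~ (hex t \subset D') -> (forall v, v \notin D -> a v = 0) ->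
    (forall v, v \notin D' -> a v = 0) -> forall v, a v = 0.
  move=> DL tD /fintype.subsetPn[f ft fD'] aD aD' v.
  have [s sE] := hex_dependency DL tD aD a0.
  have := aD' f fD'; rewrite sE => /eqP; rewrite mulf_eq0 (negPf (hex_sign_neq0 ft)).
  by rewrite orbF => /eqP s0; rewrite sE s0 mul0r.
have zero : (forall v, a v = 0) -> \sum_v a v * ((v \in X)%:R - (v \in Y)%:R) = 0.
  by move=> az; rewrite big1 // => v _; rewrite az mul0r.
have [X0 noB|t e tE tB ep Xe] := flipsP XB.
  have [Y0 noC|t' e' t'E t'C e'p Ye'] := flipsP YC.
    by rewrite X0 Y0 big1 // => v _; rewrite subrr mulr0.
  exact: (zero (vanish t' C B CL t'C (noB _ t'E) aC aB)).
have [tC|tC] := boolP (hex t \subset C); last first.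
  exact: (zero (vanish t B C BL tB tC aB aC)).
have [Y0 noC|t' e' t'E t'C e'p Ye'] := flipsP YC; first by have := noC t tE; rewrite tC.
have tt' : t' = t by apply: hex_uniq CL t'C tC.
rewrite tt' in e'p; have [s sE] := hex_dependency BL tB aB a0.
under eq_bigr do rewrite mulrBr; rewrite sumrB Xe Ye' !sum_set1 !sE.
have [-> // _ _] := hex_signE t e; have [-> // _ _] := hex_signE t e'.
by rewrite subrr.
Qed.

Lemma flips_subdivision E : subdivision p (refine_cells p (grid_height x) (flips E)).
Proof.
apply: refine_cells_subdivision => [B X|B y _|B C X Y].
- exact: flips_cell.
- exact: flips_cover.
- exact: flips_affine.
Qed.

(** The subdivision determines [E]: each hexagon in [E] loses a vertex in every cell containing it,
    while the others survive in some cell. *)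
Lemma flips_mem E t : 2 * n%:R + 1 <= x -> t \in E <->
  ~ exists2 D, D \in refine_cells p (grid_height x) (flips E) & hex t \subset D.
Proof.
move=> x_large; split=> [tE [D /refine_cellsP[B [X [BL XB ->]]] tD]|H].
  have tB : hex t \subset B := fintype.subset_trans tD (subsetDl _ _).
  have [_ /(_ t tE)|t' e t'E t'B ep Xe] := flipsP XB; first by rewrite tB.
  have tt' : t' = t by apply: hex_uniq BL t'B tB.
  have := fintype.subsetP tD e; rewrite finset.in_setD Xe finset.set11 /= => /(_ _)/wrap[|//].
  by apply: plus_hex; rewrite -tt'.
apply: contrapT => tE; apply: H; have [C CL tC] := hex_in_lower_cell t x_large.
exists C => //; apply/refine_cellsP; exists C, finset.set0; rewrite finset.setD0.
split=> //; rewrite /flips; case: pickP => [t' /andP[t'E t'C]|_].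
  by case: tE; rewrite (hex_uniq CL tC t'C).
by rewrite finset.set11.
Qed.

End Generic.

Lemma card_subdivisions_ge : (2 ^ (n * n) <=
  #|regular_subdivisions p| + #|nonregular_subdivisions p|)%N.
Proof.
have [x x_large x_generic] := grid_height_generic.
pose F E := refine_cells p (grid_height x) (flips E).
have sub E E' : F E = F E' -> E \subset E'.
  move=> FE; apply/fintype.subsetP => t /(flips_mem _ _ x_large) H.
  by apply/(flips_mem _ _ x_large); rewrite -/(F E') -FE.
have Finj : injective F.
  by move=> E E' FE; apply/eqP; rewrite finset.eqEsubset !sub.
have -> : (2 ^ (n * n))%N = #|F @: [set: {set 'I_n * 'I_n}]%SET|.
  by rewrite card_imset // -powersetT card_powerset cardsT card_prod card_ord.
apply: (@leq_trans #|regular_subdivisions p :|: nonregular_subdivisions p|).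
  apply: subset_leq_card; apply/fintype.subsetP => _ /imsetP[E _ ->].
  rewrite !inE; have dF := flips_subdivision x_generic E.
  have [r|nr] := pselect (is_regular p (F E)).
    by apply/orP; left; apply/asboolP.
  by apply/orP; right; apply/asboolP.
by rewrite cardsU leq_subr.
Qed.

End Hexagons.

(** * Asymptotics *)

Lemma expn_le_ffact m n : ((n - m) ^ m <= n ^_ m)%N.
Proof.
elim: m n => // m IH n; rewrite expnS ffactnS leq_mul ?leq_subr //.
by apply: leq_trans (IH _); apply: expn_mono; lia.
Qed.

(** With [m] half of [k], the factorial is at least [(k.+1 - m) ^ m], where [k <= (k.+1 - m) ^ 2]
    and [2 * k <= 8 * m]. *)
Lemma expn_le_fact k : (4 <= k)%N -> (k ^ k <= k.+1`! ^ 8)%N.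
Proof.
move=> k4; pose m := k./2.
have km : (k = m.*2 + odd k)%N by rewrite /m addnC odd_double_half.
have le1 : ((k.+1 - m) ^ m <= k.+1`!)%N.
  rewrite -(@ffact_fact k.+1 m); last by lia.
  by rewrite (leq_trans (expn_le_ffact m k.+1)) // leq_pmulr // fact_gt0.
have le2 : (k <= (k.+1 - m) ^ 2)%N.
  have [y my] : exists y, m = (y + 2)%N by exists (m - 2)%N; lia.
  have -> : (k.+1 - m = y + 3 + odd k)%N by lia.
  by rewrite km my -mulnn; case: odd; nia.
apply: leq_trans (expn_mono 8 le1).
apply: (@leq_trans (((k.+1 - m) ^ 2) ^ k)); first exact: expn_mono.
by rewrite -!expnM leq_pexp2l //; lia.
Qed.

(** Here [y <= k ^ 2], a further factor [k ^ 2] absorbs the constants, and [k.+1 <= 2 * k] in the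
    exponent. *)
Lemma regular_bound_le (l k : nat) : (2 * (l.+1 * l.+1) + 2 <= k)%N ->
  ((3 * (l.+1 * l.+1 * k.+1) ^ (2 * l).+1 + 1) ^ (l.+1 * k.+1) <=
   k ^ (8 * (l.+1 * l.+1) * k))%N.
Proof.
move=> lk; pose y := (l.+1 * l.+1 * k.+1)%N.
have yk : (y <= k ^ 2)%N by rewrite /y -mulnn; nia.
have y0 : (0 < y ^ (2 * l).+1)%N by rewrite expn_gt0 /y muln_gt0.
have le1 : (3 * y ^ (2 * l).+1 + 1 <= k ^ (4 * l.+1))%N.
  apply: (@leq_trans (k ^ 2 * y ^ (2 * l).+1)).
    apply: (@leq_trans (4 * y ^ (2 * l).+1)); first by lia.
    by rewrite leq_mul2r -mulnn; apply/orP; right; nia.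
  have -> : (4 * l.+1 = 2 + 2 * (2 * l).+1)%N by lia.
  by rewrite expnD leq_mul2l expnM expn_mono ?orbT.
apply: leq_trans (expn_mono _ le1) _; rewrite -expnM leq_pexp2l //; first by lia.
by nia.
Qed.

Lemma sqrtn_spec k : exists2 s, (s * s <= k)%N & (k < s.+1 * s.+1)%N.
Proof.
elim: k => [|k [s s1 s2]]; first by exists 0%N.
by have [lt|le] := ltnP k.+1 (s.+1 * s.+1); [exists s|exists s.+1] => //; lia.
Qed.

(** With [s] the integer square root of [k], [k <= 2 ^ (2 * s)] turns the left side into a power of
    2 with exponent [16 * c * s * k + 1]. Since [k <= 8 * n], this is at most [n * n] once
    [s >= 1024 * c + 64]; the 64 pays for the factor 2. *)
Lemma polylog_le_expn (c k : nat) : ((1024 * c + 65) ^ 2 <= k)%N ->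
  (2 * k ^ (8 * c * k) <= 2 ^ ((k.+1 %/ 4) * (k.+1 %/ 4)))%N.
Proof.
move=> ck; have [s s1 s2] := sqrtn_spec k.
set n := (_ %/ 4)%N; have kn : (k <= 8 * n)%N by rewrite /n; lia.
have sc : (1024 * c + 64 <= s)%N.
  by rewrite leqNgt; apply/negP => sc; move: ck s2; rewrite -mulnn; nia.
have ks : (k <= 2 ^ (2 * s))%N.
  rewrite mulnC expnM -mulnn (leq_trans (ltnW s2)) // leq_mul //; exact: ltn_expl.
apply: (@leq_trans (2 * (2 ^ (2 * s)) ^ (8 * c * k))).
  by rewrite leq_mul2l expn_mono.
rewrite -expnM -expnS leq_pexp2l //.
have le1 : (k * (s * (1024 * c + 64)) <= 64 * (n * n))%N.
  apply: (@leq_trans (k * k)); last by nia.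
  by rewrite leq_mul2l (leq_trans _ s1) ?orbT // leq_mul2l sc orbT.
have k0 : (0 < k)%N by lia.
have s0 : (0 < s)%N by lia.
by nia.
Qed.

(** * From bounds on natural numbers to growth of binary logarithms *)

Section Asymptotics.
Variable R : realType.

Definition log2 (m : nat) : R := ln m%:R / ln 2.

Lemma ln2_gt0 : 0 < ln 2 :> R. Proof. by rewrite ln_gt0 // ltr1n. Qed.

Lemma log2_ge0 m : (0 < m)%N -> 0 <= log2 m.
Proof. by move=> m0; rewrite divr_ge0 ?(ltW ln2_gt0) // ln_ge0 // ler1n. Qed.

Lemma powR_log2 m : (0 < m)%N -> m%:R = 2 `^ log2 m.
Proof.
move=> m0; rewrite /powR pnatr_eq0 /= divfK ?lt0r_neq0 ?ln2_gt0 //.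
by rewrite lnK // posrE ltr0n.
Qed.

Lemma ler_log2 m n : (0 < m)%N -> (m <= n)%N -> log2 m <= log2 n.
Proof.
move=> m0 mn; rewrite ler_pM2r ?invr_gt0 ?ln2_gt0 // ler_ln ?posrE ?ltr0n ?ler_nat //.
exact: leq_trans mn.
Qed.

Lemma log2X m e : (0 < m)%N -> log2 (m ^ e) = e%:R * log2 m.
Proof. by move=> m0; rewrite /log2 natrX lnXn ?ltr0n // -[ln _ *+ _]mulr_natl mulrA. Qed.

Lemma theta_of_nat_bounds (N : nat -> nat) (c K : nat) :
  (forall k, K <= k -> k ^ k <= N k ^ 8)%N ->
  (forall k, K <= k -> N k <= k ^ (c * k))%N ->
  exists2 f : nat -> R, f =Theta_\oo (fun k : nat => k%:R * ln k%:R : R) &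
    \forall k \near \oo, (N k)%:R = 2 `^ f k.
Proof.
move=> lowN upN.
have N0 k : (K <= k)%N -> (1 <= k)%N -> (0 < N k)%N.
  move=> Kk k1; have := lowN k Kk; rewrite lt0n; case: eqP => // ->.
  by rewrite exp0n // leqn0 expn_eq0; case: (k) k1.
exists (log2 \o N); last first.
  by exists (maxn K 1) => // k /=; rewrite geq_max => /andP[Kk k1]; apply/powR_log2/N0.
rewrite eqThetaE qualifE; apply/asboolP.
(* The exponent 8 of the lower bound gives the first constant; the successor of [c] keeps the second
   one positive. *)
exists ((8 * ln 2)^-1, c.+1%:R / ln 2).
  by rewrite /= invr_gt0 divr_gt0 ?mulr_gt0 ?ln2_gt0.
exists (maxn K 1) => // k /=; rewrite geq_max => /andP[Kk k1].
have lnk : 0 <= k%:R * ln k%:R :> R by rewrite mulr_ge0 // ln_ge0 // ler1n.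
have logN := log2_ge0 (N0 k Kk k1).
have l2 := ln2_gt0.
rewrite !ger0_norm //; split.
  have := ler_log2 _ (lowN k Kk); rewrite expn_gt0 k1 => /(_ isT).
  rewrite !log2X ?N0 // => H.
  have -> : (8 * ln 2)^-1 * (k%:R * ln k%:R) = k%:R * log2 k / 8.
    by rewrite /log2; field; rewrite lt0r_neq0.
  by rewrite ler_pdivrMr // [_ * 8]mulrC.
apply: (@le_trans _ _ (log2 (k ^ (c * k)))); first exact: ler_log2 (N0 _ Kk k1) (upN k Kk).
have -> : log2 (k ^ (c * k)) = c%:R / ln 2 * (k%:R * ln k%:R).
  by rewrite log2X // /log2 natrM; field; rewrite lt0r_neq0.
by rewrite ler_wpM2r // ler_wpM2r ?ler_nat // invr_ge0 ltW.
Qed.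

Lemma omega_of_nat_bound (N : nat -> nat) (K : nat) :
  (forall k, K <= k -> 2 ^ ((k.+1 %/ 4) * (k.+1 %/ 4)) <= 2 * N k)%N ->
  exists2 g : nat -> R, g =Omega_\oo (fun k : nat => k%:R ^+ 2 : R) &
    \forall k \near \oo, (N k)%:R = 2 `^ g k.
Proof.
move=> lowN.
have N0 k : (K <= k)%N -> (0 < N k)%N.
  move=> /lowN; rewrite lt0n; case: eqP => // ->.
  by rewrite muln0 leqn0 expn_eq0.
exists (log2 \o N); last by exists K => //= k Kk; apply/powR_log2/N0.
rewrite eqOmegaE qualifE; apply/asboolP; exists (128%:R^-1); first by rewrite invr_gt0.
exists (maxn K 12) => // k /=; rewrite geq_max => /andP[Kk k12].
have l2 := ln2_gt0.
have logN := log2_ge0 (N0 k Kk).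
rewrite (ger0_norm logN) ger0_norm ?sqr_ge0 //.
set n := (k.+1 %/ 4)%N in (lowN) *.
(* From [k <= 8 * n] and [3 <= n]; the summand 128 pays for the logarithm of the factor 2 before
   [N k]. *)
have kn : (k * k + 128 <= 128 * (n * n))%N.
  have : (k <= 8 * n)%N by rewrite /n; lia.
  have : (3 <= n)%N by rewrite /n; lia.
  by nia.
have : log2 (2 ^ (n * n)) <= log2 (2 * N k) by apply: ler_log2; rewrite ?expn_gt0 // lowN.
have -> : log2 (2 * N k) = 1 + log2 (N k).
  by rewrite /log2 natrM lnM ?posrE ?ltr0n ?N0 // mulrDl divff ?lt0r_neq0.
have log22 : log2 2 = 1 by rewrite /log2 divff ?lt0r_neq0.
rewrite log2X // log22 mulr1 => H.
have : (k * k + 128)%:R <= (128 * (n * n))%:R :> R by rewrite ler_nat.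
rewrite natrD !natrM expr2 => H2; rewrite ler_pdivrMl //.
by move: H; rewrite natrM; lra.
Qed.

End Asymptotics.


Theorem theorem3 (R : realType) (l : nat) (hl : (2 <= l)%N) :
  (exists2 f : nat -> R,
     f =Theta_\oo (fun k : nat => k%:R * ln k%:R : R) &
     \forall k \near \oo,
       #|regular_subdivisions (@prod_simplices_vertex R l k)|%:R = 2 `^ f k) /\
  (exists2 g : nat -> R,
     g =Omega_\oo (fun k : nat => k%:R ^+ 2 : R) &
     \forall k \near \oo,
       #|nonregular_subdivisions (@prod_simplices_vertex R l k)|%:R = 2 `^ g k).
Proof.
pose c := (l.+1 * l.+1)%N.
split.
  apply: (@theta_of_nat_bounds _ _ (8 * c) (2 * c + 4)) => k lek.
    apply: leq_trans (expn_le_fact _) _; first by lia.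
    by apply: expn_mono; apply: card_regular_ge; exact: ltnW.
  apply: leq_trans (card_regular_le R l k) _.
  by apply: regular_bound_le; rewrite -/c; lia.
apply: (@omega_of_nat_bound _ _ ((1024 * c + 65) ^ 2)) => k lek.
have n4 : (4 * (k.+1 %/ 4) <= k.+1)%N by rewrite mulnC leq_trunc_div.
have total := card_subdivisions_ge R hl n4.
have few := polylog_le_expn lek.
have reg : (#|regular_subdivisions (@prod_simplices_vertex R l k)| <=
    k ^ (8 * c * k))%N.
  apply: leq_trans (card_regular_le R l k) _; apply: regular_bound_le.
  by rewrite -/c; apply: leq_trans lek; rewrite -mulnn; nia.
(* The regular subdivisions number at most half of [2 ^ (n * n)], where [n = k.+1 %/ 4], so the
   non-regular ones make up at least the other half. *)
by move: total few reg; rewrite -/c; lia.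
Qed.
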